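(* Let $s\in(0,1)$, $p\geq2$, and let $\Omega\subset\mathbb{R}^n$ be any domain (bounded or not) satisfying the uniform two-sided ball condition. Let $u\in C^{1,1}_{loc}(\Omega)\cap\mathcal{L}_{sp}(\mathbb{R}^n)$ be a bounded positive solution ($u>0$ in $\Omega$) of $$\begin{cases}(-\Delta)^s_p u(x)=f(x,u(x)), & x\in\Omega,\\ u(x)=0, & x\in\mathbb{R}^n\setminus\Omega,\end{cases}$$ where $f(x,u)$ is bounded. Then there exists a constant $\nu_0\in(0,s)$ such that $u\in C^{\nu_0}(\mathbb{R}^n)$. Moreover, there are a constant $C(\nu_0)$ depending on $\nu_0$ and a constant $C$ such that $$[u]_{C^{\nu_0}(\mathbb{R}^n)}\leq C(\nu_0)\left[1+\|u\|_{L^\infty(\Omega)}+C\|f\|^{\frac{1}{p-1}}_{L^\infty(\Omega)}\right].$$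
   Context: The fractional $p$-Laplacian is defined pointwise by $$(-\Delta)^s_p u(x)=C_{n,s,p}\,\mathrm{P.V.}\int_{\mathbb{R}^n}\frac{|u(x)-u(y)|^{p-2}[u(x)-u(y)]}{|x-y|^{n+sp}}\,dy = C_{n,s,p}\lim_{\epsilon\to0^+}\int_{\mathbb{R}^n\setminus B_\epsilon(x)}\frac{|u(x)-u(y)|^{p-2}[u(x)-u(y)]}{|x-y|^{n+sp}}\,dy,$$ where $C_{n,s,p}>0$ is a constant depending only on $n,s,p$. The space $\mathcal{L}_{sp}=\mathcal{L}_{sp}(\mathbb{R}^n)$ is $$\mathcal{L}_{sp}=\left\{u\in L^{p-1}_{loc}(\mathbb{R}^n)\ :\ \int_{\mathbb{R}^n}\frac{|1+u(x)|^{p-1}}{1+|x|^{n+sp}}\,dx<\infty\right\}.$$ $C^{1,1}_{loc}(\Omega)$ is the space of functions that are continuously differentiable in $\Omega$ with locally Lipschitz gradient in $\Omega$. The equation is understood pointwise in $\Omega$. $\|f\|_{L^\infty(\Omega)}$ denotes the $L^\infty(\Omega)$ norm of $x\mapsto f(x,u(x))$. The Hölder seminorm is $[u]_{C^{\nu}(\mathbb{R}^n)}=\sup_{x\neq y}\frac{|u(x)-u(y)|}{|x-y|^{\nu}}$. The uniform two-sided ball condition for $\Omega$ means: there is a radius $R>0$ such that for every $z\in\partial\Omega$ there are open balls $B\subset\Omega$ and $B'\subset\mathbb{R}^n\setminus\overline{\Omega}$ of radius $R$ with $z\in\partial B\cap\partial B'$. *)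

(* Defs.v *)
From HB Require Import structures.
From mathcomp Require Import all_boot all_order all_algebra.
From mathcomp Require Import all_classical all_reals all_analysis.

Set Implicit Arguments.
Unset Strict Implicit.
Unset Printing Implicit Defensive.

Import Order.TTheory GRing.Theory Num.Theory.
Import numFieldNormedType.Exports.

Local Open Scope classical_set_scope.
Local Open Scope ring_scope.

(* The sigma-algebra of 'rV[R]_n is generated by the coordinates; it is the
   Borel sigma-algebra. *)
Definition measure_rV_display : measure_display -> measure_display.
Proof. exact. Qed.

Section measurable_rV.
Context {R : realType} (n : nat).

Let coors : 'I_n -> 'rV[R]_n -> measurableTypeR R := fun i x => x ord0 i.

Let rV_set0 : g_sigma_preimage coors set0.
Proof. exact: sigma_algebra0. Qed.

Let rV_setC A : g_sigma_preimage coors A -> g_sigma_preimage coors (~` A).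
Proof. exact: sigma_algebraC. Qed.

Let rV_bigcup (F : _^nat) : (forall i, g_sigma_preimage coors (F i)) ->
  g_sigma_preimage coors (\bigcup_i (F i)).
Proof. exact: sigma_algebra_bigcup. Qed.

HB.instance Definition _ := @isMeasurable.Build
  (measure_rV_display default_measure_display) 'rV[R]_n
  (g_sigma_preimage coors) rV_set0 rV_setC rV_bigcup.

End measurable_rV.

Lemma measurable_rV_coord (R : realType) n (i : 'I_n) :
  measurable_fun [set: 'rV[R]_n] (fun x => x ord0 i : measurableTypeR R).
Proof.
move=> _ Y mY; rewrite setTI; apply: sub_sigma_algebra => /=.
rewrite -bigcup_seq/=; exists i => /=; first by rewrite mem_index_enum.
by exists Y => //; rewrite setTI.
Qed.

Lemma measurable_fun_rVP d (T : measurableType d) (R : realType) n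
    (f : T -> 'rV[R]_n) :
  (forall i, measurable_fun [set: T] (fun x => f x ord0 i : measurableTypeR R)) ->
  measurable_fun [set: T] f.
Proof.
move=> mf _ A mA; rewrite setTI.
suff : image_set_system setT f measurable A by rewrite /image_set_system/= setTI.
apply: mA; split; first exact/sigma_algebra_image/sigma_algebra_measurable.
move=> B; rewrite -bigcup_seq/= => -[i _ [C mC <-]].
by rewrite /image_set_system/= setTI; exact: mf.
Qed.

(* Lebesgue measure on 'rV[R]_n: the n-fold product of the Lebesgue measure on
   R, see lebesgue_rV_box. *)
Section lebesgue_rV.
Context {R : realType}.
Local Open Scope ereal_scope.

Definition cons_rV n (x : measurableTypeR R * 'rV[R]_n) : 'rV[R]_n.+1 :=
  row_mx (const_mx x.1 : 'rV[R]_1) x.2.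

Definition uncons_rV n (v : 'rV[R]_n.+1) : measurableTypeR R * 'rV[R]_n :=
  (v ord0 ord0, \row_i v ord0 (lift ord0 i)).

Lemma cons_rVK n : cancel (@cons_rV n) (@uncons_rV n).
Proof.
move=> [a v]; congr pair.
  transitivity (cons_rV (a, v) ord0 (lshift n (ord0 : 'I_1))).
    by congr (cons_rV _ _ _); exact: val_inj.
  by apply: etrans (row_mxEl _ _ _ _) _; rewrite mxE.
apply/rowP => i; rewrite mxE /=.
transitivity (cons_rV (a, v) ord0 (rshift 1 i)).
  by congr (cons_rV _ _ _); exact: val_inj.
exact: row_mxEr.
Qed.

Lemma measurable_cons_rV n : measurable_fun setT (@cons_rV n).
Proof.
apply: measurable_fun_rVP => i.
have [j ->|j ->] := split_ordP (i : 'I_(1 + n)).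
  apply: (eq_measurable_fun fst); last exact: measurable_fst.
  by move=> x _; apply/esym/(etrans (row_mxEl _ _ _ _)); rewrite mxE.
apply: (eq_measurable_fun ((fun y : 'rV[R]_n => y ord0 j) \o snd)).
  by move=> x _; exact/esym/row_mxEr.
by apply: measurableT_comp; [exact: measurable_rV_coord|exact: measurable_snd].
Qed.

Lemma measurable_uncons_rV n : measurable_fun setT (@uncons_rV n).
Proof.
apply/measurable_fun_pair => /=; first exact: measurable_rV_coord.
apply: measurable_fun_rVP => i; under eq_fun do rewrite mxE.
exact: measurable_rV_coord.
Qed.

Section cons_measure.
Variables (n : nat) (m : {sigma_finite_measure set 'rV[R]_n -> \bar R}).

Definition cons_measure : set 'rV[R]_n.+1 -> \bar R :=
  pushforward ((@lebesgue_measure R) \x m) (@cons_rV n).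

Let mcons (A : set 'rV[R]_n.+1) :
  measurable A -> measurable (@cons_rV n @^-1` A).
Proof.
by move=> mA; rewrite -[X in measurable X]setTI; exact: measurable_cons_rV.
Qed.

Let cons_measure0 : cons_measure set0 = 0.
Proof. by rewrite /cons_measure /pushforward preimage_set0 measure0. Qed.

Let cons_measure_ge0 A : 0 <= cons_measure A.
Proof. by rewrite /cons_measure /pushforward measure_ge0. Qed.

Let cons_measure_sigma_additive : semi_sigma_additive cons_measure.
Proof.
move=> F mF tF mUF; rewrite /cons_measure /pushforward preimage_bigcup.
apply: measure_semi_sigma_additive.
- by move=> k; exact: mcons.
- apply/trivIsetP => /= i j _ _ ij; rewrite -preimage_setI.
  by move/trivIsetP : tF => /(_ _ _ _ _ ij) ->//; rewrite preimage_set0.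
- by rewrite -preimage_bigcup; exact: mcons.
Qed.

HB.instance Definition _ := isMeasure.Build _ _ _ cons_measure
  cons_measure0 cons_measure_ge0 cons_measure_sigma_additive.

Let cons_measure_sigma_finite : sigma_finite setT cons_measure.
Proof.
have /sigma_finiteP[F [TF ndF Foo]] := sigma_finiteT (@lebesgue_measure R).
have /sigma_finiteP[G [TG ndG Goo]] := sigma_finiteT m.
exists (fun k => @uncons_rV n @^-1` (F k `*` G k)).
  rewrite -preimage_bigcup; apply/esym; rewrite -subTset => v _ /=.
  have [i _ Fi] : (\bigcup_i F i) (uncons_rV v).1 by rewrite -TF.
  have [j _ Gj] : (\bigcup_i G i) (uncons_rV v).2 by rewrite -TG.
  exists (maxn i j) => //; split.
  - by move: Fi; exact/subsetPset/ndF/leq_maxl.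
  - by move: Gj; exact/subsetPset/ndG/leq_maxr.
move=> k; have [mFk Fk] := Foo k; have [mGk Gk] := Goo k; split.
  rewrite -[X in measurable X]setTI; apply: measurable_uncons_rV => //.
  exact: measurableX.
rewrite /cons_measure /pushforward -comp_preimage.
rewrite (_ : _ \o _ = id); last by apply/funext => x /=; rewrite cons_rVK.
rewrite preimage_id [ltLHS]product_measure1E// lte_mul_pinfty//.
by rewrite ge0_fin_numE.
Qed.

HB.instance Definition _ := Measure_isSigmaFinite.Build _ _ _
  cons_measure cons_measure_sigma_finite.
End cons_measure.

Fixpoint lebesgue_rV n : {sigma_finite_measure set 'rV[R]_n -> \bar R} :=
  if n is n'.+1 then cons_measure (lebesgue_rV n') else \d_(0%R : 'rV[R]_0).

Lemma lebesgue_rV_box n (A : 'I_n -> set (measurableTypeR R)) :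
  (forall i, measurable (A i)) ->
  lebesgue_rV n [set x : 'rV[R]_n | forall i, A i (x ord0 i)] =
  \prod_(i < n) lebesgue_measure (A i).
Proof.
elim: n A => [|n IH] A mA /=.
  by rewrite big_ord0 diracE mem_set//= => -[].
rewrite big_ord_recl /cons_measure /pushforward -IH; last by move=> i; exact: mA.
rewrite -product_measure1E//; last first.
  rewrite (_ : mkset _ = \bigcap_(i in [set: 'I_n])
      (fun x : 'rV[R]_n => x ord0 i) @^-1` (A (lift ord0 i))).
    apply: fin_bigcap_measurable => // i _.
    by rewrite -[X in measurable X]setTI; exact: measurable_rV_coord.
  by apply/seteqP; split => [x Ax i _|x Ax i]; exact: Ax.
have consE (x : measurableTypeR R * 'rV[R]_n) :
    cons_rV x ord0 ord0 = x.1 /\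
    forall i, cons_rV x ord0 (lift ord0 i) = x.2 ord0 i.
  have xE := cons_rVK x; split; first exact: (congr1 fst xE).
  move=> i; have /(congr1 snd)/rowP/(_ i)/= := xE.
  by rewrite mxE.
congr (_ \x _); apply/seteqP; split => [x Ax|x [A0 AS] i].
  have [x1 x2] := consE x; split => [|i] /=; first by rewrite -x1; exact: Ax.
  by rewrite -x2; exact: Ax.
have [x1 x2] := consE x.
by have [j ->|->] := unliftP ord0 i; [rewrite x2; exact: AS|rewrite x1].
Qed.

End lebesgue_rV.

(* The library norm on 'rV[R]_n is the sup norm, so the Euclidean norm and its
   balls are defined here; the topology is the same. *)
Section euclidean.
Context {R : realType} {n : nat}.
Implicit Types (x y : 'rV[R]_n) (A Omega : set 'rV[R]_n).

Definition enorm x : R := Num.sqrt (\sum_(i < n) x ord0 i ^+ 2).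

Definition eball x (r : R) : set 'rV[R]_n := [set y | enorm (y - x) < r].

Definition boundary A : set 'rV[R]_n := closure A `\` interior A.

Definition domain Omega := [/\ open Omega, connected Omega & Omega !=set0].

Definition two_sided_ball_condition Omega :=
  exists2 r : R, 0 < r & forall z, boundary Omega z -> exists c c' : 'rV[R]_n,
    [/\ eball c r `<=` Omega, eball c' r `<=` ~` closure Omega,
        boundary (eball c r) z & boundary (eball c' r) z].

End euclidean.

Section function_spaces.
Context {R : realType} {n : nat}.
Implicit Types (u : 'rV[R]_n -> R) (Omega : set 'rV[R]_n) (s p nu : R).

Local Notation mu := (lebesgue_rV n).

Definition grad u (x : 'rV[R]_n) : 'rV[R]_n :=
  \row_i 'D_(delta_mx ord0 i) u x.

Definition C11loc Omega u := forall x, Omega x ->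
  [/\ differentiable u x, {for x, continuous (grad u)} &
      exists2 V, nbhs x V & [lipschitz grad u y | y in V]].

(* The sigma-algebra of 'rV[R]_n is not complete; Lebesgue measurable functions
   are those that agree a.e. with a Borel function. *)
Definition lebesgue_measurable_fun u :=
  exists2 g : 'rV[R]_n -> R, measurable_fun [set: 'rV[R]_n] g &
    {ae mu, forall x, u x = g x}.

Definition Lloc (q : R) u := lebesgue_measurable_fun u /\
  forall K : set 'rV[R]_n, compact K ->
    (\int[mu]_(x in K) (`|u x| `^ q)%:E < +oo)%E.

Definition Lsp s p u := Lloc (p - 1) u /\
  (\int[mu]_x (`|1 + u x| `^ (p - 1) /
                 (1 + enorm x `^ (n%:R + s * p)))%:E < +oo)%E.

(* The L^oo norm over Omega, as that of the extension by 0. *)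
Definition Linfty_norm Omega u : \bar R :=
  'N[mu]_+oo[(fun x => (u x * \1_Omega x)%:E)]%E.

Definition holder_seminorm nu u : \bar R :=
  ereal_sup [set (`|u x.1 - u x.2| / enorm (x.1 - x.2) `^ nu)%:E
            | x in [set x : 'rV[R]_n * 'rV[R]_n | x.1 != x.2]].

Definition holder_space nu u :=
  [bounded u x | x in [set: 'rV[R]_n]] /\ (holder_seminorm nu u < +oo)%E.

End function_spaces.

Section fractional_p_laplacian.
Context {R : realType} {n : nat}.
Implicit Types (u : 'rV[R]_n -> R) (x y : 'rV[R]_n) (s p : R).

(* When p = 2 and u x = u y the integrand is 0 `^ 0 * 0 = 0, as it should. *)
Definition fplap_trunc s p u x (eps : R) : \bar R :=
  (\int[lebesgue_rV n]_(y in ~` eball x eps)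
    (`|u x - u y| `^ (p - 2) * (u x - u y) /
       enorm (x - y) `^ (n%:R + s * p))%:E)%E.

Definition fplap_cvg s p u x := cvg (fplap_trunc s p u x eps @[eps --> 0^'+]).

(* lim is meaningful only under fplap_cvg. *)
Definition fplap (Cnsp s p : R) u x : \bar R :=
  (Cnsp%:E * lim (fplap_trunc s p u x eps @[eps --> 0^'+]))%E.

Definition dirichlet_solution (Cnsp s p : R) (Omega : set 'rV[R]_n)
    (f : 'rV[R]_n -> R -> R) u :=
  (forall x, Omega x ->
     fplap_cvg s p u x /\ fplap Cnsp s p u x = (f x (u x))%:E) /\
  (forall x, ~ Omega x -> u x = 0).

End fractional_p_laplacian.

(* Main.v *)
Require Import Defs.
From mathcomp Require Import all_boot all_order all_algebra.
From mathcomp Require Import all_classical all_reals all_analysis.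
From mathcomp Require Import measurable_realfun ess_sup_inf.
From mathcomp Require Import ring lra.
Import Order.TTheory GRing.Theory Num.Theory.
Import numFieldNormedType.Exports.
Local Open Scope classical_set_scope.
Local Open Scope ring_scope.

(** Idea of the proof.  The bound is obtained by doubling the variables, with a Hoelder
    exponent [nu] that is small; no barrier and no comparison principle is needed.

    Let [phi t = (t + kap) `^ nu] with [kap > 0], and let [L] be the supremum of
    [(u x - u y) / phi |x - y|], which is finite because [u] is bounded and [kap > 0].
    If [L] is bounded by [C * (sup u + N `^ (p - 1)^-1)], where [N] bounds [|f| / Cnsp],
    with a constant that does not see [kap], then the choice [kap = |x - y|] gives the
    Hoelder estimate for the pair [(x, y)] (lemmas [modulus_quotient_bound] and
    [holder_estimate]).

    Take an almost optimal pair [(x0, y0)] at distance [r].  If [r] is not small, then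
    [L <= C * sup u].  Otherwise, either the ball of radius [2 * r] about [x0] lies in
    [Omega] (lemma [interior_estimate]), or it meets the complement; since [u] is
    positive inside and zero outside, [y0] may in the second case be replaced by the
    point of the complement nearest to [x0], and the pair stays almost optimal because
    [2 `^ nu] is almost 1 (lemma [boundary_estimate]).

    A penalised maximum near [(x0, y0)] is attained at some [(x1, y1)] and is global
    (lemma [doubled_max_global]).  With [rho = |x1 - y1|] and [A = L * phi rho], it says
    that [u] is touched from above at [x1], and [- u] at [y1] in the interior case, in
    two ways: by a linear function plus [K0 * A / rho ^+ 2] times the squared distance
    (lemma [touching_near_bound]), and by [A] times a fixed power [sg] of
    [1 + |w - x1| / rho] times a factor that tends to 0 with [nu] (lemma
    [touching_far_bound]).  In the principal value at [x1], the points that pull down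
    therefore count little: on the ball of radius [th * rho] the linear part is odd and
    cancels, which leaves [th `^ (p - s * p)] times [A `^ (p - 1) * rho `^ (- (s * p))]
    up to a constant, and outside of this ball the factor is small.  On the other hand [u]
    falls by at least [A / 3] below [u x1] on a set of measure comparable to
    [rho ^+ n] at distance comparable to [rho]: on a ball where [u] vanishes, given by
    the exterior ball condition, or, in the interior case, among the points near the
    middle of [x1] and [y1], because each of them is far in value from [u x1] or from
    [u y1].  So the principal value is at least a constant times
    [A `^ (p - 1) * rho `^ (- (s * p))], hence at least a constant times [L `^ (p - 1)],
    while it is at most [N] by the equation (lemma [touching_estimate]).

    The essential supremum of [f] bounds the equation at almost every point only, perhaps
    not at [x1].  The principal value is therefore taken at points close to [x1]: the
    [C^{1,1}] regularity gives there a quadratic bound with uniform constants, and its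
    contribution is small on a small enough ball, whatever these constants are. *)

Set Implicit Arguments.
Unset Strict Implicit.
Unset Printing Implicit Defensive.

(** * The Euclidean norm *)

Section euclidean_norm.
Context {R : realType} {n : nat}.
Implicit Types x y z a : 'rV[R]_n.

Definition dotp x y : R := \sum_(i < n) x ord0 i * y ord0 i.

Lemma dotpC x y : dotp x y = dotp y x.
Proof. by apply: eq_bigr => i _; rewrite mulrC. Qed.

Lemma dotpDl x y z : dotp (x + y) z = dotp x z + dotp y z.
Proof. by rewrite -big_split; apply: eq_bigr => i _; rewrite !mxE mulrDl. Qed.

Lemma dotpNl x y : dotp (- x) y = - dotp x y.
Proof. by rewrite -sumrN; apply: eq_bigr => i _; rewrite !mxE mulNr. Qed.

Lemma dotpZl k x y : dotp (k *: x) y = k * dotp x y.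
Proof. by rewrite mulr_sumr; apply: eq_bigr => i _; rewrite !mxE mulrA. Qed.

Lemma dotpDr x y z : dotp z (x + y) = dotp z x + dotp z y.
Proof. by rewrite dotpC dotpDl !(dotpC z). Qed.

Lemma dotpNr x y : dotp y (- x) = - dotp y x.
Proof. by rewrite dotpC dotpNl dotpC. Qed.

Lemma dotp_ge0 x : 0 <= dotp x x.
Proof. by apply: sumr_ge0 => i _; rewrite -expr2 sqr_ge0. Qed.

Lemma enorm_ge0 x : 0 <= enorm x. Proof. exact: sqrtr_ge0. Qed.

Lemma sqr_enorm x : enorm x ^+ 2 = dotp x x.
Proof.
rewrite /enorm /dotp (eq_bigr (fun i => x ord0 i * x ord0 i)) => [|i _].
  by rewrite sqr_sqrtr //; exact: dotp_ge0.
by rewrite expr2.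
Qed.

Lemma enorm0 : enorm (0 : 'rV[R]_n) = 0.
Proof. by rewrite /enorm big1 ?sqrtr0 // => i _; rewrite mxE expr0n. Qed.

Lemma enormN x : enorm (- x) = enorm x.
Proof. by congr Num.sqrt; apply: eq_bigr => i _; rewrite mxE sqrrN. Qed.

Lemma enormB x y : enorm (x - y) = enorm (y - x).
Proof. by rewrite -enormN opprB. Qed.

Lemma coord_le_enorm x i : `|x ord0 i| <= enorm x.
Proof.
rewrite -ler_sqr ?nnegrE ?enorm_ge0// sqr_enorm /dotp (bigD1 i)//=.
rewrite -normrX ger0_norm ?sqr_ge0// expr2 lerDl.
by apply: sumr_ge0 => j _; rewrite -expr2 sqr_ge0.
Qed.

Lemma enorm_eq0 x : enorm x = 0 -> x = 0.
Proof.
move=> x0; apply/rowP => i; rewrite mxE; apply/eqP; rewrite -normr_le0.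
by rewrite -x0 coord_le_enorm.
Qed.

Lemma enorm_gt0 x : x != 0 -> 0 < enorm x.
Proof.
by move=> x0; rewrite lt0r enorm_ge0 andbT; apply: contra_neq x0; exact: enorm_eq0.
Qed.

Lemma dotp_le x y : dotp x y <= enorm x * enorm y.
Proof.
have [->|x0] := eqVneq x 0.
  by rewrite enorm0 mul0r /dotp big1 // => i _; rewrite mxE mul0r.
have [->|y0] := eqVneq y 0.
  by rewrite enorm0 mulr0 /dotp big1 // => i _; rewrite mxE mulr0.
have := dotp_ge0 (enorm y *: x - enorm x *: y).
rewrite dotpDl !dotpDr !dotpNl !dotpNr !dotpZl ![dotp _ (_ *: _)]dotpC !dotpZl.
rewrite -!sqr_enorm (dotpC y x) => h.
have xy : 0 < enorm x * enorm y by rewrite mulr_gt0 ?enorm_gt0.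
rewrite -(ler_pM2l xy); nra.
Qed.

Lemma normr_dotp_le x y : `|dotp x y| <= enorm x * enorm y.
Proof.
by rewrite ler_norml lerNl -dotpNl dotp_le -(enormN x) dotp_le.
Qed.

Lemma sqr_enormD x y :
  enorm (x + y) ^+ 2 = enorm x ^+ 2 + 2 * dotp x y + enorm y ^+ 2.
Proof. by rewrite !sqr_enorm dotpDl !dotpDr (dotpC y x); ring. Qed.

Lemma enormD x y : enorm (x + y) <= enorm x + enorm y.
Proof.
rewrite -ler_sqr ?nnegrE ?addr_ge0 ?enorm_ge0// sqr_enormD sqrrD.
have := dotp_le x y; rewrite -mulr_natl; lra.
Qed.

Lemma enorm_distD z x y : enorm (x - y) <= enorm (x - z) + enorm (z - y).
Proof. by apply: le_trans (enormD _ _); rewrite subrKA. Qed.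

Lemma enormZ k x : enorm (k *: x) = `|k| * enorm x.
Proof.
apply/eqP; rewrite -(eqrXn2 (_ : 0 < 2)%N) ?mulr_ge0 ?enorm_ge0//.
by rewrite exprMn !sqr_enorm dotpZl dotpC dotpZl -normrX ger0_norm ?sqr_ge0// mulrA.
Qed.

Lemma enorm_le_sum x : enorm x <= \sum_(i < n) `|x ord0 i|.
Proof.
have s0 : 0 <= \sum_(i < n) `|x ord0 i| by apply: sumr_ge0.
rewrite -ler_sqr ?nnegrE ?enorm_ge0// sqr_enorm expr2 mulr_suml.
apply: ler_sum => i _; rewrite (le_trans (ler_norm _))// normrM.
by rewrite ler_wpM2l// (bigD1 i)//= lerDl sumr_ge0.
Qed.

(** Concavity of the square root: the tangent at [a] of the norm, plus a quadratic
    correction, is a global upper bound. *)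
Lemma enormD_le_quad a z : 0 < enorm a ->
  enorm (a + z) <= enorm a + (2 * dotp a z + enorm z ^+ 2) / (2 * enorm a).
Proof.
move=> a0; have az := sqr_enormD a z.
rewrite -lerBlDl ler_pdivlMr ?mulr_gt0// ?ltr0n//.
have := sqr_ge0 (enorm (a + z) - enorm a); nra.
Qed.

End euclidean_norm.

(** * Real powers *)

Section power_inequalities.
Context {R : realType}.
Implicit Types a b t e m nu : R.

(** Young's inequality with second factor 1. *)
Lemma bernoulli_powR m a : 1 <= m -> 0 <= a -> 1 + m * (a - 1) <= a `^ m.
Proof.
move=> m1 a0; have [->|m1'] := eqVneq m 1.
  by rewrite powRr1//; lra.
have m1'' : 1 < m by rewrite lt_neqAle eq_sym m1' m1.
have m0 : 0 < m by lra.
have q0 : 0 < m / (m - 1) by rewrite divr_gt0// subr_gt0.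
have m0' : m != 0 by rewrite gt_eqF.
have m1n : m - 1 != 0 by rewrite subr_eq0.
have pq : m^-1 + (m / (m - 1))^-1 = 1 by field; rewrite m1n m0'.
have := @conjugate_powR R a 1 m (m / (m - 1)) a0 ler01 m0 q0 pq.
rewrite powR1 mulr1 => h.
have : m * a <= m * (a `^ m / m + 1 / (m / (m - 1))) by rewrite ler_wpM2l// ltW.
have -> : m * (a `^ m / m + 1 / (m / (m - 1))) = a `^ m + (m - 1).
  by field; rewrite ?m1n ?m0'.
lra.
Qed.

(** The convex case applied to the exponent [nu^-1] at the point [a `^ nu]. *)
Lemma bernoulli_powR_concave nu a : 0 < nu <= 1 -> 0 <= a ->
  a `^ nu <= 1 + nu * (a - 1).
Proof.
move=> /andP[nu0 nu1] a0.
have := @bernoulli_powR nu^-1 (a `^ nu).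
rewrite -powRrM mulfV ?gt_eqF// powRr1// powR_ge0 invf_ge1// nu1 => /(_ isT isT) h.
have : nu * (1 + nu^-1 * (a `^ nu - 1)) <= nu * a by rewrite ler_wpM2l// ltW.
rewrite mulrDr mulrA mulfV ?gt_eqF//; lra.
Qed.

(** The convex Bernoulli inequality at [a / b], rescaled by [b `^ m]. *)
Lemma powR_le_linear m a b : 1 <= m -> 0 <= a -> a <= b ->
  b `^ m - a `^ m <= m * b `^ (m - 1) * (b - a).
Proof.
move=> m1 a0 ab; have m0 : 0 < m by lra.
have [b0|b0] := eqVneq b 0.
  have ab0 : a = b by apply: le_anti; rewrite ab/= b0.
  by rewrite ab0 !subrr mulr0.
have b0' : 0 < b by rewrite lt0r b0 (le_trans a0).
have ab0 : 0 <= a / b by rewrite divr_ge0// ltW.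
have := bernoulli_powR m1 ab0.
rewrite -(ler_pM2l (powR_gt0 m b0')) -powRM//; last exact: ltW.
rewrite (mulrC b) divfK// -(mulr_powRB1 (ltW b0') m0) => h.
have -> : m * b `^ (m - 1) * (b - a) =
  b * b `^ (m - 1) - b * b `^ (m - 1) * (1 + m * (a / b - 1)).
  by field.
lra.
Qed.

End power_inequalities.

Section signed_power.
Context {R : realType} (p : R).
Implicit Types a b t e : R.

Definition spow t : R := `|t| `^ (p - 2) * t.

Lemma spowE t : 2 <= p -> 0 <= t -> spow t = t `^ (p - 1).
Proof.
move=> p2 t0; rewrite /spow ger0_norm// mulrC.
have [t00|t0'] := eqVneq t 0.
  rewrite t00 mul0r powR0//; apply: lt0r_neq0; lra.
have -> : p - 2 = (p - 1) - 1 by ring.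
by apply: mulr_powRB1 => //; lra.
Qed.

Lemma spowN t : spow (- t) = - spow t.
Proof. by rewrite /spow normrN mulrN. Qed.

Lemma spow_ge0 t : 0 <= t -> 0 <= spow t.
Proof. by move=> t0; rewrite mulr_ge0// powR_ge0. Qed.

Lemma normr_spow t : 2 <= p -> `|spow t| = `|t| `^ (p - 1).
Proof. by move=> p2; rewrite -spowE// /spow normrM normr_id ger0_norm ?powR_ge0. Qed.

Lemma ler_spow a b : 2 <= p -> a <= b -> spow a <= spow b.
Proof.
move=> p2; have H x y : 0 <= x -> x <= y -> spow x <= spow y.
  move=> x0 xy; rewrite !spowE//; last lra.
  by apply: ge0_ler_powR; rewrite ?nnegrE//; lra.
have [a0|a0] := leP 0 a; first exact: H.
have [b0|b0] := leP 0 b => ab.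
  rewrite -[a]opprK spowN (le_trans (y := 0))// ?spow_ge0//.
  by rewrite oppr_le0 spow_ge0//; lra.
by rewrite -[a]opprK -[b]opprK !(spowN (- _)) lerN2 H//; lra.
Qed.

(** By oddness the two occurrences of [t] cancel up to the perturbation [e]: this is the
    gain of the symmetrisation of a principal value. *)
Lemma spow_symm_ge t e : 2 <= p -> 0 <= e ->
  - (2 * (p - 1) * e * (`|t| + e) `^ (p - 2)) <= spow (t - e) + spow (- t - e).
Proof.
move=> p2 e0; wlog t0 : t / 0 <= t.
  move=> H; have [/H//|t0] := leP 0 t.
  have Nt0 : 0 <= - t by lra.
  by have := H _ Nt0; rewrite normrN opprK [leRHS]addrC.
rewrite -opprD spowN (ger0_norm t0) -[leRHS]opprB lerN2.
have te0 : 0 <= t + e by lra.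
rewrite (spowE p2 te0); have [et|te] := leP e t.
  rewrite spowE ?subr_ge0//.
  have := @powR_le_linear R (p - 1) (t - e) (t + e) _ _ _.
  have -> : p - 1 - 1 = p - 2 by ring.
  have -> : t + e - (t - e) = 2 * e by ring.
  move=> h; have := h ltac:(lra) ltac:(lra) ltac:(lra); nra.
rewrite -[t - e]opprB spowN opprK spowE//; last lra.
have P x : 0 <= x -> x <= t + e -> x `^ (p - 1) <= x * (t + e) `^ (p - 2).
  move=> x0 xte; rewrite -(@mulr_powRB1 _ x (p - 1))//; last lra.
  have -> : p - 1 - 1 = p - 2 by ring.
  by rewrite ler_wpM2l//; apply: ge0_ler_powR; rewrite ?nnegrE//; lra.
have h1 := P _ te0 (lexx _); have h2 := P (e - t) ltac:(lra) ltac:(lra).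
have q0 : 0 <= (t + e) `^ (p - 2) by exact: powR_ge0.
have : 0 <= (p - 2) * (e * (t + e) `^ (p - 2)).
  by rewrite !mulr_ge0//; lra.
nra.
Qed.

End signed_power.

Section modulus.
Context {R : realType} (nu kap : R).
Implicit Types t : R.

(** Adding [kap] keeps the quotient of an increment by the modulus bounded. *)
Definition modulus t : R := (t + kap) `^ nu.

Lemma modulus_gt0 t : 0 < kap -> 0 <= t -> 0 < modulus t.
Proof. by move=> kap0 t0; rewrite powR_gt0//; lra. Qed.

Lemma ler_modulus t t' : 0 < nu <= 1 -> 0 < kap -> 0 <= t -> t <= t' ->
  modulus t <= modulus t'.
Proof.
case/andP=> n0 _ kap0 t0 tt'; apply: ge0_ler_powR; rewrite ?nnegrE; lra.
Qed.

(** The shift [kap] only helps: [k * t + kap <= k * (t + kap)]. *)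
Lemma modulus_scale k t : 0 < nu <= 1 -> 0 < kap -> 1 <= k -> 0 <= t ->
  modulus (k * t) <= k `^ nu * modulus t.
Proof.
case/andP=> n0 _ kap0 k1 t0; rewrite /modulus -powRM//; [|lra|lra].
apply: ge0_ler_powR; rewrite ?nnegrE; nra.
Qed.

(** Concavity: the tangent line at [t] lies above the graph. *)
Lemma modulus_tangent t t' : 0 < nu <= 1 -> 0 < kap -> 0 <= t -> 0 <= t' ->
  modulus t' <= modulus t * (1 + nu * ((t' - t) / (t + kap))).
Proof.
move=> nu01 kap0 t0 t'0; have tk : 0 < t + kap by lra.
have tk' : t + kap != 0 by rewrite gt_eqF.
have -> : modulus t' = modulus t * ((t' + kap) / (t + kap)) `^ nu.
  rewrite /modulus -powRM; [|exact: ltW|].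
    by rewrite mulrC divfK.
  by rewrite divr_ge0; lra.
rewrite ler_wpM2l//; first exact: ltW (modulus_gt0 _ _).
have -> : (t' - t) / (t + kap) = (t' + kap) / (t + kap) - 1 by field.
by apply: bernoulli_powR_concave => //; rewrite divr_ge0; lra.
Qed.

Lemma modulus_ge_powR t : 0 < nu <= 1 -> 0 < kap -> 0 <= t -> t `^ nu <= modulus t.
Proof.
by case/andP=> n0 _ kap0 t0; apply: ge0_ler_powR; rewrite ?nnegrE; lra.
Qed.

End modulus.

(** As [nu] tends to 0 the power [nu] grows negligibly, relatively to a fixed power. *)
Lemma powR_growth (R : realType) (nu sg t : R) : 0 < nu -> nu <= sg -> 0 <= t ->
  (1 + t) `^ nu - 1 <= nu / sg * (1 + t) `^ sg.
Proof.
move=> nu0 nusg t0; have sg0 : 0 < sg by lra.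
have -> : (1 + t) `^ nu = ((1 + t) `^ sg) `^ (nu / sg).
  by rewrite -powRrM mulrC divfK// gt_eqF.
have h := @bernoulli_powR_concave R (nu / sg) ((1 + t) `^ sg) _ (powR_ge0 _ _).
have q : 0 < nu / sg by rewrite divr_gt0.
have := h _; rewrite q ler_pdivrMr// mul1r => /(_ nusg); nra.
Qed.

(** * Euclidean balls and Borel sets *)

Section topology.
Context {R : realType} {n : nat}.
Implicit Types (x y z : 'rV[R]_n) (A : set 'rV[R]_n).

Lemma ball_rVP x y (e : R) : 0 < e ->
  ball x e y <-> forall i, `|x ord0 i - y ord0 i| < e.
Proof.
move=> e0; split => [[_ h] i|h].
  by have := h ord0 i.
by split => // i j; rewrite (ord1 i); exact: h.
Qed.

Lemma eball_sub_ball x (e : R) : 0 < e -> eball x e `<=` ball x e.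
Proof.
move=> e0 y yx; apply/ball_rVP => // i; rewrite distrC.
by apply: le_lt_trans yx; have := coord_le_enorm (y - x) i; rewrite !mxE.
Qed.

Lemma ball_sub_eball x (e : R) : 0 < e -> ball x (e / n.+1%:R) `<=` eball x e.
Proof.
move=> e0 y /ball_rVP; rewrite divr_gt0// => /(_ isT) h.
apply: le_lt_trans (enorm_le_sum _) _.
have s : \sum_(i < n) `|(y - x) ord0 i| <= \sum_(i < n) (e / n.+1%:R).
  by apply: ler_sum => i _; rewrite !mxE distrC ltW.
apply: le_lt_trans s _.
rewrite sumr_const card_ord -[ltLHS]mulr_natr mulrAC ltr_pdivrMr// ltr_pM2l// ltr_nat//.
Qed.

Lemma nbhs_eballP x A :
  nbhs x A <-> exists2 e : R, 0 < e & eball x e `<=` A.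
Proof.
split => [/nbhs_ballP[e /= e0 eA]|[e e0 eA]].
  by exists e => //; apply: subset_trans eA; exact: eball_sub_ball.
apply/nbhs_ballP; exists (e / n.+1%:R) => /=; first by rewrite divr_gt0.
by apply: subset_trans eA; exact: ball_sub_eball.
Qed.

Lemma nbhs_eball x (e : R) : 0 < e -> nbhs x (eball x e).
Proof. by move=> e0; apply/nbhs_eballP; exists e. Qed.

Lemma enorm_lipschitz x y : `|enorm x - enorm y| <= enorm (x - y).
Proof.
rewrite ler_norml; apply/andP; split.
  by have := enormD (y - x) x; rewrite subrK enormB; lra.
by have := enormD (x - y) y; rewrite subrK; lra.
Qed.

Lemma continuous_enormB c : continuous (fun x => enorm (x - c)).
Proof.
move=> x; apply/(@cvgrPdist_lt _ _ _ (nbhs x)) => e e0.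
near=> y; have yx : eball x e y by near: y; exact: nbhs_eball.
apply: le_lt_trans (enorm_lipschitz _ _) _.
by rewrite opprB addrA subrK enormB.
Unshelve. all: by end_near.
Qed.

Lemma open_eball x (e : R) : open (eball x e).
Proof.
rewrite (_ : eball x e = (fun y => enorm (y - x)) @^-1` [set t | t < e])//.
by apply: open_comp; [move=> y _; exact: continuous_enormB|exact: open_lt].
Qed.

Lemma mx_norm_le_enorm x : `|x| <= enorm x.
Proof.
rewrite /Num.norm/= mx_normrE; apply: bigmax_le; first exact: enorm_ge0.
by move=> [i j] _ /=; rewrite (ord1 i); exact: coord_le_enorm.
Qed.

Lemma compact_cball x (r : R) : compact [set y | enorm (y - x) <= r].
Proof.
apply: bounded_closed_compact.
  exists (`|x| + r); split; first exact: num_real.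
  move=> M Mr y /= yx; apply: ltW; apply: le_lt_trans Mr.
  rewrite -[y](subrK x) addrC (le_trans (ler_normD _ _))// lerD2l.
  exact: le_trans (mx_norm_le_enorm _) yx.
rewrite (_ : [set y | _] = (fun y => enorm (y - x)) @^-1` [set t | t <= r])//.
by apply: preimage_closed; [move=> y _; exact: continuous_enormB|exact: closed_le].
Qed.

Lemma measurable_box (q : 'rV[R]_n) (e : R) :
  measurable [set y : 'rV[R]_n | forall i, `|q ord0 i - y ord0 i| < e].
Proof.
rewrite (_ : mkset _ = \bigcap_(i in [set: 'I_n])
    (fun x : 'rV[R]_n => x ord0 i) @^-1` [set t | `|q ord0 i - t| < e]).
  apply: fin_bigcap_measurable => // i _.
  rewrite -[X in measurable X]setTI; apply: measurable_rV_coord => //.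
  apply: open_measurable.
  have -> : [set t | `|q ord0 i - t| < e] = ball (q ord0 i) e by [].
  exact: ball_open.
by apply/seteqP; split => [x Ax i _|x Ax i]; exact: Ax.
Qed.

(** Rational boxes form a countable base of the topology. *)
Lemma open_measurable_rV A : open A -> measurable A.
Proof.
move=> oA.
pose B (i : 'rV[rat]_n * nat) : set 'rV[R]_n :=
  [set y | forall j, `|(map_mx ratr i.1 : 'rV[R]_n) ord0 j - y ord0 j| < i.2.+1%:R^-1].
have -> : A = \bigcup_i (if `[< B i `<=` A >] then B i else set0).
  apply/seteqP; split => [x Ax|x [i _]]; last by case: asboolP => // iA /iA.
  have /nbhs_ballP[e /= e0 eA] : nbhs x A by exact: open_nbhs_nbhs.
  have [k _ ke] : exists2 k : nat, True & k.+1%:R^-1 < e / 2.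
    have [k] := near_infty_natSinv_lt (PosNum (divr_gt0 e0 (ltr0n R 2))).
    by move=> _ /(_ k (leqnn k)) h; exists k.
  have k0 : 0 < k.+1%:R^-1 :> R by rewrite invr_gt0.
  set d : R := k.+1%:R^-1 in ke k0 *.
  have /choice[q Hq] : forall j : 'I_n, exists q : rat,
      `|ratr q - x ord0 j| < d.
    move=> j; have [q] := @rat_in_itvoo R (x ord0 j) (x ord0 j + d) ltac:(lra).
    rewrite in_itv/= => /andP[q1 q2]; exists q; rewrite ltr_norml; apply/andP; split; lra.
  exists (\row_j q j, k) => //; case: asboolP => [_|[]].
    by move=> j; rewrite !mxE /=; exact: Hq.
  move=> y By; apply: eA; apply/ball_rVP => // j.
    have := By j; have := Hq j; rewrite !mxE /= -/d => h1 h2.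
    rewrite (le_lt_trans (ler_distD (ratr (q j)) _ _))// distrC; lra.
apply: countable_bigcupT_measurable => [|i]; first exact: countableP.
by case: asboolP => // _; exact: measurable_box.
Qed.

(** Lower semicontinuity suffices, and nothing more is known of a solution at the boundary
    of the domain before the estimate is proved. *)
Lemma lsc_measurable_rV (f : 'rV[R]_n -> R) :
  (forall c, open [set x | c < f x]) -> measurable_fun [set: 'rV[R]_n] f.
Proof.
move=> openf; apply: (measurability _ (RGenOInfty.measurableE R)).
move=> /= _ [_ [a ->] <-]; apply: measurableI => //; apply: open_measurable_rV.
rewrite (_ : _ @^-1` _ = [set x | a < f x]) //.
by apply/seteqP; split => x /=; rewrite in_itv/= andbT.
Qed.

Lemma measurable_enormB (x : 'rV[R]_n) :
  measurable_fun [set: 'rV[R]_n] (fun w => enorm (w - x)).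
Proof.
apply: lsc_measurable_rV => c.
rewrite (_ : mkset _ = (fun w => enorm (w - x)) @^-1` [set t | c < t])//.
by apply: open_comp; [move=> y _; exact: continuous_enormB|exact: open_gt].
Qed.

End topology.

(** * Volumes and reflections *)

Section volumes.
Context {R : realType} {n : nat}.
Implicit Types (x y z : 'rV[R]_n) (A : set 'rV[R]_n).
Local Notation mu := (@lebesgue_rV R n).

Lemma lebesgue_rV_cube x (e : R) : 0 < e ->
  mu [set y : 'rV[R]_n | forall i, `|x ord0 i - y ord0 i| < e] = ((2 * e) ^+ n)%:E.
Proof.
move=> e0; have mA i : measurable (ball (x ord0 i) e : set (measurableTypeR R)).
  have := @open_measurable R (ball (x ord0 i) e) (ball_open _ _).
  exact.
have -> : [set y : 'rV[R]_n | forall i, `|x ord0 i - y ord0 i| < e] =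
          [set y : 'rV[R]_n | forall i, ball (x ord0 i) e (y ord0 i)] by [].
rewrite (lebesgue_rV_box mA) (eq_bigr (fun=> (2 * e)%:E)) => [|i _].
  by rewrite prodEFin prodr_const card_ord.
by rewrite lebesgue_measure_ball ?ltW// mulr_natl.
Qed.

Lemma measurable_eball x (e : R) : measurable (eball x e).
Proof. by apply: open_measurable_rV; exact: open_eball. Qed.

Lemma lebesgue_eball_le x (e : R) : 0 < e -> (mu (eball x e) <= ((2 * e) ^+ n)%:E)%E.
Proof.
move=> e0; rewrite -(lebesgue_rV_cube x e0); apply: le_measure.
- by rewrite inE; exact: measurable_eball.
- by rewrite inE; exact: measurable_box.
- by move=> y /(eball_sub_ball e0)/ball_rVP; exact.
Qed.

Lemma lebesgue_eball_ge x (e : R) : 0 < e ->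
  (((2 * (e / n.+1%:R)) ^+ n)%:E <= mu (eball x e))%E.
Proof.
move=> e0; have e1 : 0 < e / n.+1%:R by rewrite divr_gt0.
rewrite -(lebesgue_rV_cube x e1); apply: le_measure.
- by rewrite inE; exact: measurable_box.
- by rewrite inE; exact: measurable_eball.
- by move=> y yx; apply: ball_sub_eball => //; apply/ball_rVP.
Qed.

End volumes.

Section reflection.
Context {R : realType}.

Lemma lebesgue_measure_reflection (c : R) (A : set R) : measurable A ->
  lebesgue_measure ((fun x : measurableTypeR R => c - x : measurableTypeR R) @^-1` A)
  = lebesgue_measure A.
Proof.
move=> mA.
pose r (x : measurableTypeR R) : measurableTypeR R := c - x.
have mr : measurable_fun setT r by apply: measurable_funB => //; exact: measurable_cst.
apply/esym; apply: (@lebesgue_measure_unique R (pushforward lebesgue_measure r)) => //.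
move=> _ [[a b]] /= ab <-.
rewrite /pushforward.
have -> : r @^-1` `]a, b] = `[c - b, c - a[%classic.
  apply/seteqP; split => x /=; rewrite !in_itv/= /r => /andP[h1 h2]; apply/andP; split; lra.
rewrite !lebesgue_measure_itv/= !lte_fin ltrD2l ltrN2.
by case: ifP => // _; rewrite -!EFinD; congr EFin; ring.
Qed.

Lemma cons_rV0 n (x : measurableTypeR R * 'rV[R]_n) : cons_rV x ord0 ord0 = x.1.
Proof. exact: (congr1 fst (cons_rVK x)). Qed.

Lemma cons_rVS n (x : measurableTypeR R * 'rV[R]_n) i :
  cons_rV x ord0 (lift ord0 i) = x.2 ord0 i.
Proof. by have /(congr1 snd)/rowP/(_ i)/= := cons_rVK x; rewrite mxE. Qed.

Lemma measurable_reflection n (c : 'rV[R]_n) :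
  measurable_fun [set: 'rV[R]_n] (fun w => c - w).
Proof.
apply: measurable_fun_rVP => i; under eq_fun do rewrite !mxE.
by apply: measurable_funB; [exact: measurable_cst|exact: measurable_rV_coord].
Qed.

(** By induction on the dimension: the measure is a product, and a measure on a product is
    determined by its values on the rectangles. *)
Lemma lebesgue_rV_reflection n (c : 'rV[R]_n) (A : set 'rV[R]_n) : measurable A ->
  lebesgue_rV n ((fun w => c - w) @^-1` A) = lebesgue_rV n A.
Proof.
elim: n c A => [|n IH] c A mA /=.
  rewrite !diracE; congr (_ %:R%:E); congr nat_of_bool.
  by apply/idP/idP; rewrite !inE /=; congr A; apply/rowP => -[].
rewrite /cons_measure /pushforward.
pose c1 := (uncons_rV c).1; pose c2 := (uncons_rV c).2.
pose r1 (x : measurableTypeR R) : measurableTypeR R := c1 - x.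
pose r2 (x : 'rV[R]_n) : 'rV[R]_n := c2 - x.
pose r (x : measurableTypeR R * 'rV[R]_n) := (r1 x.1, r2 x.2).
have mr1 : measurable_fun setT r1 by apply: measurable_funB => //; exact: measurable_cst.
have mr2 : measurable_fun setT r2 by exact: measurable_reflection.
have mr : measurable_fun setT r.
  by apply/measurable_fun_pair => /=; apply: measurableT_comp.
have -> : @cons_rV R n @^-1` ((fun w => c - w) @^-1` A) = r @^-1` (@cons_rV R n @^-1` A).
  have cB x : c - cons_rV x = cons_rV (r x).
    apply/rowP => i; rewrite mxE; have [j ->|->] := unliftP ord0 i.
      by rewrite [(- cons_rV x) _ _]mxE !cons_rVS /r2 /= /c2 /uncons_rV /= !mxE.
    by rewrite [(- cons_rV x) _ _]mxE !cons_rV0.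
  by apply/seteqP; split => x /=; rewrite cB.
have mA' : measurable (@cons_rV R n @^-1` A).
  by rewrite -[X in measurable X]setTI; exact: measurable_cons_rV.
apply/esym; apply: (@product_measure_unique _ _ _ _ R lebesgue_measure (lebesgue_rV n)
  (pushforward (lebesgue_measure \x lebesgue_rV n)%E r)) => //.
move=> B C mB mC.
transitivity ((lebesgue_measure \x lebesgue_rV n)%E ((r1 @^-1` B) `*` (r2 @^-1` C))) => //.
rewrite product_measure1E//.
- by congr (_ * _)%E; [exact: lebesgue_measure_reflection|exact: IH].
- by rewrite -[X in measurable X]setTI; exact: mr1.
- by rewrite -[X in measurable X]setTI; exact: mr2.
Qed.

End reflection.

(** * Radial integrals *)

Section countable_cover_bound.
Context d (T : measurableType d) (R : realType) (mu : {measure set T -> \bar R}).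
Local Open Scope ereal_scope.

Lemma geometric_nneseries_le (a q : R) (u : (\bar R)^nat) :
  (0 <= a)%R -> (0 <= q < 1)%R ->
  (forall k, 0 <= u k) -> (forall k, u k <= (a * q ^+ k)%:E) ->
  \sum_(0 <= k <oo) u k <= (a / (1 - q))%:E.
Proof.
move=> a0 /andP[q0 q1] u0 ua.
apply: lime_le; first by apply: is_cvg_nneseries => k _ _; exact: u0.
near=> m; apply: (@le_trans _ _ (\sum_(0 <= k < m) (a * q ^+ k)%:E)).
  by apply: lee_sum => k _; exact: ua.
rewrite sumEFin lee_fin.
have -> : (\sum_(0 <= k < m) a * q ^+ k = series (geometric a q) m)%R by [].
rewrite geometric_seriesE ?lt_eqF//= ler_wpM2r ?invr_ge0 ?subr_ge0 ?(ltW q1)//.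
by rewrite ler_piMr ?gerBl ?exprn_ge0.
Unshelve. all: by end_near.
Qed.

(** The pieces may overlap: only their total weight counts. *)
Lemma integral_le_geometric (D : set T) (f : T -> R) (S : (set T)^nat)
    (c m : R ^nat) (a q : R) :
  measurable D -> measurable_fun D f -> (forall w, D w -> (0 <= f w)%R) ->
  (forall k, measurable (S k)) -> (forall k, (0 <= c k)%R) ->
  (forall w, D w -> exists2 k, S k w & (f w <= c k)%R) ->
  (forall k, mu (S k) <= (m k)%:E) ->
  (0 <= q < 1)%R -> (0 <= a)%R -> (forall k, (c k * m k <= a * q ^+ k)%R) ->
  \int[mu]_(w in D) (f w)%:E <= (a / (1 - q))%:E.
Proof.
move=> mD mf f0 mS c0 cover muS q01 a0 cm.
pose F k w : \bar R := ((c k)%:E * (\1_(S k) w)%:E).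
have mF k : measurable_fun D (F k).
  apply: measurable_funTS; apply: emeasurable_funM; first exact: measurable_cst.
  by apply/measurable_EFinP; exact: measurable_indic.
have F0 k w : 0 <= F k w by rewrite mule_ge0 ?lee_fin ?c0.
apply: (@le_trans _ _ (\int[mu]_(w in D) \sum_(0 <= k <oo) F k w)).
  apply: ge0_le_integral => //.
  - by have /measurable_EFinP := mf.
  - by apply: ge0_emeasurable_sum => // k w _ _; exact: F0.
  - move=> w Dw; have [k Sk fk] := cover w Dw.
    have := @nneseries_lim_ge R (F^~ w) xpredT 0 k.+1 (fun k _ _ => F0 k w).
    apply: le_trans; rewrite big_nat_recr//=.
    apply: (@le_trans _ _ (F k w)).
      by rewrite /F indicE mem_set// mule1 lee_fin.
    by rewrite leeDr// sume_ge0.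
rewrite integral_nneseries//.
apply: geometric_nneseries_le => // k.
  by apply: integral_ge0 => w _; exact: F0.
rewrite /F ge0_integralZl_EFin//; last first.
  by apply: measurable_funTS; apply/measurable_EFinP; exact: measurable_indic.
rewrite integral_indic//.
apply: (@le_trans _ _ ((c k)%:E * (m k)%:E)).
  rewrite lee_wpmul2l ?lee_fin//; apply: le_trans (muS k).
  by rewrite le_measure ?inE//; exact: measurableI.
by rewrite -EFinM lee_fin.
Qed.

End countable_cover_bound.

Section radial_integrals.
Context {R : realType} {n : nat}.
Implicit Types (x w : 'rV[R]_n) (g t dl : R).
Local Notation mu := (@lebesgue_rV R n).

Lemma dyadic_exists t : 1 <= t -> exists k : nat, 2 ^+ k <= t < 2 ^+ k.+1.
Proof.
move=> t1; have tlt m : m%:R < 2 ^+ m :> R.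
  by rewrite -natrX ltr_nat ltn_expl.
have [m Pm] : exists m, t < 2 ^+ m.
  exists (Num.bound t); apply: lt_trans (tlt _).
  by apply: archi_boundP; lra.
have ex : exists m, t < 2 ^+ m by exists m.
have := ex_minnP ex; case=> -[|k] tk min.
  by move: tk; rewrite expr0; lra.
exists k; rewrite tk andbT leNgt; apply/negP => /min; rewrite ltnn//.
Qed.

Lemma powR_comparable g t a : 0 < a -> a / 2 <= t <= 2 * a ->
  t `^ g <= 2 `^ `|g| * a `^ g.
Proof.
move=> a0 /andP[ta1 ta2]; have t0 : 0 < t by lra.
have [g0|g0] := leP 0 g.
  rewrite (ger0_norm g0) -powRM//; last exact: ltW.
  by apply: ge0_ler_powR; rewrite ?nnegrE//; lra.
have -> : t `^ g = (t^-1) `^ (- g).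
  by rewrite -powR_inv1 ?ltW// -powRrM mulN1r opprK.
have -> : a `^ g = (a^-1) `^ (- g).
  by rewrite -(@powR_inv1 _ a) ?ltW// -powRrM mulN1r opprK.
rewrite (ltr0_norm g0) -powRM ?invr_ge0//; last exact: ltW.
apply: ge0_ler_powR; rewrite ?nnegrE ?invr_ge0 ?mulr_ge0 ?invr_ge0//; try lra.
by rewrite -[2]invrK -invfM lef_pV2 ?posrE//; [lra|rewrite mulr_gt0 ?invr_gt0].
Qed.

(** The numerator comes from the oscillation of the integrand on a dyadic shell and from the
    volume of the shell, the denominator from the geometric series over the shells. *)
Definition radial_const g : R := 2 `^ `|g| * 16 ^+ n / (1 - 2 `^ (- `|g|)).

Lemma radial_const_ge0 g : 0 <= radial_const g.
Proof.
rewrite /radial_const divr_ge0 ?mulr_ge0 ?powR_ge0 ?exprn_ge0 ?subr_ge0//.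
rewrite powRN invf_le1 ?powR_gt0//.
have h : 1 `^ `|g| <= 2 `^ `|g| :> R by rewrite ge0_ler_powR ?nnegrE// ler1n.
by rewrite powR1 in h.
Qed.

Lemma measurable_enormB_powR x g :
  measurable_fun [set: 'rV[R]_n] (fun w => enorm (w - x) `^ g / enorm (w - x) ^+ n).
Proof.
have me := @measurable_enormB R n x.
apply: (eq_measurable_fun (fun w => enorm (w - x) `^ g * enorm (w - x) `^ (- n%:R))).
  by move=> w _; rewrite powR_invn ?enorm_ge0.
by apply: measurable_funM; apply: measurableT_comp (@measurable_powR R _) me.
Qed.

(** Covering by the balls of radii [4 * b ^+ k * dl], where [b] is 2 for the exterior of a
    ball and [2^-1] for a punctured ball: on the [k]-th shell the integrand times the
    volume is at most a constant times [(b `^ g) ^+ k], and [b `^ g < 1] in both cases. *)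
Lemma integral_radial_le x g (D : set 'rV[R]_n) dl b : g != 0 -> 0 < dl ->
  measurable D -> 0 < b -> b `^ g = 2 `^ (- `|g|) ->
  (forall w, D w -> exists k : nat,
     b ^+ k * dl / 2 <= enorm (w - x) <= 2 * (b ^+ k * dl)) ->
  (\int[mu]_(w in D) (enorm (w - x) `^ g / enorm (w - x) ^+ n)%:E
    <= (radial_const g * dl `^ g)%:E)%E.
Proof.
move=> g0 dl0 mD b0 bg cover.
have a0 k : 0 < b ^+ k * dl by rewrite mulr_gt0// exprn_gt0.
pose c k := 2 `^ `|g| * (b ^+ k * dl) `^ g / (b ^+ k * dl / 2) ^+ n.
pose S k := eball x (4 * (b ^+ k * dl)).
pose m k := (2 * (4 * (b ^+ k * dl))) ^+ n.
have q1 : 2 `^ (- `|g|) < 1 :> R.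
  rewrite powRN invf_lt1 ?powR_gt0//.
  have h : 1 `^ `|g| < 2 `^ `|g| :> R.
    by rewrite gt0_ltr_powR ?normr_gt0 ?nnegrE// ltr1n.
  by rewrite powR1 in h.
have -> : radial_const g * dl `^ g =
  (2 `^ `|g| * 16 ^+ n * dl `^ g) / (1 - 2 `^ (- `|g|)).
  by rewrite /radial_const mulrAC.
apply: (@integral_le_geometric _ _ _ _ _ _ S c m) => //.
- by apply: measurable_funTS; exact: measurable_enormB_powR.
- by move=> w _; rewrite divr_ge0 ?powR_ge0 ?exprn_ge0 ?enorm_ge0.
- by move=> k; exact: measurable_eball.
- by move=> k; rewrite /c divr_ge0 ?mulr_ge0 ?powR_ge0 ?exprn_ge0 ?ltW// divr_gt0.
- move=> w /cover[k hk]; have := a0 k; case/andP: (hk) => h1 h2 ak.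
  exists k; first by rewrite /S /=; apply: le_lt_trans h2 _; rewrite ltr_pM2r//; lra.
  rewrite /c; apply: ler_pM; rewrite ?powR_ge0 ?invr_ge0 ?exprn_ge0 ?enorm_ge0//.
    by apply: powR_comparable.
  rewrite lef_pV2 ?posrE ?exprn_gt0 ?divr_gt0//; last first.
    by apply: lt_le_trans h1; rewrite divr_gt0.
  by rewrite lerXn2r ?nnegrE ?enorm_ge0// divr_ge0// ltW.
- by move=> k; apply: lebesgue_eball_le; rewrite mulr_gt0.
- by rewrite powR_ge0.
- by rewrite !mulr_ge0 ?powR_ge0 ?exprn_ge0.
- move=> k; rewrite /c /m.
  have -> : 2 * (4 * (b ^+ k * dl)) = 16 * (b ^+ k * dl / 2) by field.
  rewrite [(16 * _) ^+ n]exprMn; set Y := (b ^+ k * dl / 2) ^+ n.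
  have Y0 : Y != 0 by rewrite gt_eqF// exprn_gt0// divr_gt0.
  set Z := (b ^+ k * dl) `^ g.
  have -> : 2 `^ `|g| * Z / Y * (16 ^+ n * Y) = 2 `^ `|g| * Z * 16 ^+ n by field.
  rewrite /Z.
  rewrite powRM ?exprn_ge0 ?(ltW dl0) ?(ltW b0)//.
  have -> : (b ^+ k) `^ g = (2 `^ (- `|g|)) ^+ k.
    by rewrite -bg -!powR_mulrn ?powR_ge0 ?(ltW b0)// -!powRrM mulrC.
  have -> : 2 `^ `|g| * (2 `^ (- `|g|) ^+ k * dl `^ g) * 16 ^+ n =
    2 `^ `|g| * 16 ^+ n * dl `^ g * 2 `^ (- `|g|) ^+ k by ring.
  exact: lexx.
Qed.

End radial_integrals.

Section radial_corollaries.
Context {R : realType} {n : nat}.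
Implicit Types (x w z : 'rV[R]_n) (g dl : R).
Local Notation mu := (@lebesgue_rV R n).

Lemma integral_radial_far x g dl : 0 < g -> 0 < dl ->
  (\int[mu]_(w in ~` eball x dl) (enorm (w - x) `^ (- g) / enorm (w - x) ^+ n)%:E
    <= (@radial_const R n (- g) * dl `^ (- g))%:E)%E.
Proof.
move=> g0 dl0; apply: (integral_radial_le (b := 2)) => //.
- by rewrite oppr_eq0 gt_eqF.
- by apply: measurableC; exact: measurable_eball.
- by rewrite normrN gtr0_norm.
- move=> w /=; rewrite /eball/= => /negP; rewrite -leNgt => wx.
  have [|k /andP[k1 k2]] := @dyadic_exists R (enorm (w - x) / dl).
    by rewrite ler_pdivlMr// mul1r.
  exists k; move: k1 k2; rewrite ler_pdivlMr// ltr_pdivrMr// exprS.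
  have : 0 < 2 ^+ k * dl by rewrite mulr_gt0// exprn_gt0.
  by rewrite -mulrA => ? ? ?; apply/andP; split; lra.
Qed.

Lemma integral_radial_near x g dl a : 0 < g -> 0 < a -> 0 < dl ->
  (\int[mu]_(w in eball x dl `\` eball x a) (enorm (w - x) `^ g / enorm (w - x) ^+ n)%:E
    <= (@radial_const R n g * dl `^ g)%:E)%E.
Proof.
move=> g0 a0 dl0; apply: (integral_radial_le (b := 2^-1)) => //.
- by rewrite gt_eqF.
- by apply: measurableD; exact: measurable_eball.
- by rewrite -powR_inv1// -powRrM mulN1r gtr0_norm.
- move=> w [wdl /negP]; rewrite -leNgt => aw; rewrite /eball/= in wdl.
  have w0 : 0 < enorm (w - x) by exact: lt_le_trans aw.
  have [|k /andP[k1 k2]] := @dyadic_exists R (dl / enorm (w - x)).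
    by rewrite ler_pdivlMr// mul1r ltW.
  exists k; move: k1 k2; rewrite ler_pdivlMr// ltr_pdivrMr// exprS.
  have e0 : 0 < 2 ^+ k :> R by rewrite exprn_gt0.
  rewrite exprVn => h1 h2; apply/andP; split.
    have -> : (2 ^+ k)^-1 * dl / 2 = dl / (2 * 2 ^+ k) by field; rewrite gt_eqF.
    by rewrite ler_pdivrMr ?mulr_gt0//; lra.
  have -> : 2 * ((2 ^+ k)^-1 * dl) = (2 * dl) / 2 ^+ k by field; rewrite gt_eqF.
  by rewrite ler_pdivlMr//; nra.
Qed.

End radial_corollaries.

(** * Lower bounds for the principal value *)

Section integrand.
Context {R : realType} {n : nat}.
Implicit Types (x w z q : 'rV[R]_n) (v : 'rV[R]_n -> R) (s p M K : R).
Local Notation mu := (@lebesgue_rV R n).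

Definition fplap_integrand s p v x w : R :=
  spow p (v x - v w) / enorm (x - w) `^ (n%:R + s * p).

(** The singular kernel in the form whose integrals are bounded by [radial_const]. *)
Lemma kernelE (t g : R) : 0 < t -> (t `^ (n%:R + g))^-1 = t `^ (- g) / t ^+ n.
Proof.
move=> t0; rewrite -powRN opprD powRD; last by apply/implyP => _; rewrite gt_eqF.
by rewrite powR_invn 1?mulrC// ltW.
Qed.

Lemma measurable_fplap_integrand s p v x : measurable_fun setT v ->
  measurable_fun setT (fplap_integrand s p v x).
Proof.
move=> mv; apply: measurable_funM.
  have mvx : measurable_fun setT (fun w => v x - v w).
    by apply: measurable_funB => //; exact: measurable_cst.
  apply: measurable_funM => //; apply: measurableT_comp (@measurable_powR R _) _.
  exact: measurableT_comp.
apply: (eq_measurable_fun (fun w => enorm (w - x) `^ (- (n%:R + s * p)))).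
  by move=> w _; rewrite powRN enormB.
exact: measurableT_comp (@measurable_powR R _) (measurable_enormB x).
Qed.

(** Away from [x], a bounded function is dominated by the kernel alone. *)
Lemma integrable_fplap_integrand s p v x M e :
  2 <= p -> 0 < s -> 0 < e -> measurable_fun setT v -> (forall w, `|v w| <= M) ->
  mu.-integrable (~` eball x e) (EFin \o fplap_integrand s p v x).
Proof.
move=> p2 s0 e0 mv vM; have sp0 : 0 < s * p by rewrite mulr_gt0//; lra.
have mD : measurable (~` eball x e) by apply: measurableC; exact: measurable_eball.
pose G w : R := (2 * M) `^ (p - 1) * (enorm (w - x) `^ (- (s * p)) / enorm (w - x) ^+ n).
apply: (@le_integrable _ _ _ _ _ _ _ (EFin \o G)) => //.
- by apply/measurable_EFinP; apply: measurable_funTS; exact: measurable_fplap_integrand.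
- move=> w; rewrite /eball /= => /negP; rewrite -leNgt => ew.
  have w0 : 0 < enorm (w - x) by exact: lt_le_trans ew.
  rewrite lee_fin /fplap_integrand enormB kernelE// /G [leLHS]normrM [leRHS]normrM.
  have k0 : 0 <= enorm (w - x) `^ (- (s * p)) / enorm (w - x) ^+ n.
    by rewrite divr_ge0 ?powR_ge0 ?exprn_ge0 ?enorm_ge0.
  rewrite (ger0_norm k0) ler_wpM2r// normr_spow// (ger0_norm (powR_ge0 _ _)).
  apply: ge0_ler_powR; rewrite ?nnegrE//; [lra|by have := vM 0; have := normr_ge0 (v 0); lra|].
  rewrite (le_trans (ler_normB _ _))//.
  by have := vM x; have := vM w; lra.
apply/integrableP; split.
  apply/measurable_EFinP; apply: measurable_funTS; apply: measurable_funM.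
    exact: measurable_cst.
  exact: measurable_enormB_powR.
under eq_integral => w _.
  rewrite /= ger0_norm; last first.
    by rewrite !mulr_ge0 ?powR_ge0 ?invr_ge0 ?exprn_ge0 ?enorm_ge0.
  rewrite /G EFinM.
over.
rewrite ge0_integralZl_EFin ?powR_ge0//.
- apply: le_lt_trans (_ : _ <= _ * (@radial_const R n (- (s * p)) * e `^ (- (s * p)))%:E)%E _.
    by apply: lee_wpmul2l; rewrite ?lee_fin ?powR_ge0//; exact: integral_radial_far.
  by rewrite -EFinM ltry.
- by move=> w _; rewrite lee_fin !mulr_ge0 ?powR_ge0 ?invr_ge0 ?exprn_ge0 ?enorm_ge0.
- by apply/measurable_EFinP; apply: measurable_funTS; exact: measurable_enormB_powR.
Qed.

(** The condition on [S] is its symmetry about [x]. *)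
Lemma integral_reflection x (S : set 'rV[R]_n) (f : 'rV[R]_n -> R) :
  measurable S -> measurable_fun setT f ->
  (forall w, S w <-> S (x + x - w)) ->
  mu.-integrable S (EFin \o f) ->
  mu.-integrable S (fun w => (f (x + x - w))%:E) /\
  (\int[mu]_(w in S) (f (x + x - w))%:E = \int[mu]_(w in S) (f w)%:E)%E.
Proof.
move=> mS mf symS intf.
pose r w := x + x - w.
have rK w : r (r w) = w by rewrite /r opprB addrCA subrr addr0.
have SE : r @^-1` S = S.
  by apply/seteqP; split => w /=; rewrite -/(r w) => /symS //; rewrite -/(r _) ?rK.
have mr : measurable_fun setT r by exact: measurable_reflection.
have mfr : measurable_fun setT (EFin \o (f \o r)).
  by apply/measurable_EFinP; apply: measurableT_comp.
have eqm A : measurable A -> A `<=` S -> pushforward mu r A = mu A.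
  by move=> mA _; exact: lebesgue_rV_reflection.
have intfr : mu.-integrable S (EFin \o (f \o r)).
  apply/integrableP; split; first exact: measurable_funTS.
  have mnf : measurable_fun S (fun w => `|(f w)%:E|%E).
    by apply: measurable_funTS; apply: measurableT_comp => //; exact/measurable_EFinP.
  have E : (\int[pushforward mu r]_(w in S) `|(f w)%:E| =
            \int[mu]_(w in S) `|(f (r w))%:E|)%E.
    transitivity (\int[mu]_(w in r @^-1` S) `|(f (r w))%:E|)%E; last by rewrite SE.
    exact: ge0_integral_pushforward.
  rewrite /= -E (eq_measure_integral _ eqm).
  by have /integrableP[_] := intf.
  exact: mr.
split => //.
have mfE : measurable_fun setT (EFin \o f) by exact/measurable_EFinP.
rewrite -[RHS](eq_measure_integral _ eqm).
transitivity (\int[mu]_(w in r @^-1` S) (f (r w))%:E)%E; first by rewrite SE.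
have intf' : mu.-integrable (r @^-1` S) ((EFin \o f) \o r) by rewrite SE.
by apply/esym; exact: (integral_pushforward mr mfE intf' mS).
Qed.

(** The linear part of the lower bound on [v x - v (x + z)] is odd, hence disappears
    from the sum of the values at two points symmetric about [x]. *)
Lemma fplap_integrand_symm_ge s p v x q a b K w :
  2 <= p -> 0 < a -> 0 < b -> 0 <= K ->
  (forall z, a <= enorm z < b -> - dotp q z - K * enorm z ^+ 2 <= v x - v (x + z)) ->
  a <= enorm (w - x) < b ->
  - (2 * ((p - 1) * K * (enorm q + K * b) `^ (p - 2))) *
    (enorm (w - x) `^ (p - s * p) / enorm (w - x) ^+ n) <=
  fplap_integrand s p v x w + fplap_integrand s p v x (x + x - w).
Proof.
move=> p2 a0 b0 K0 hv /andP[aw wb].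
have p10 : 0 <= p - 1 by lra.
have p20 : 0 <= p - 2 by lra.
pose z := w - x; have zE : w = x + z by rewrite /z addrCA subrr addr0.
have wE : x + x - w = x - z by rewrite zE opprD addrACA subrr add0r.
rewrite -/z in wb aw.
have z0 : 0 < enorm z by exact: lt_le_trans aw.
rewrite /fplap_integrand wE.
have -> : x - w = - z by rewrite opprB.
have -> : x - (x - z) = z by rewrite opprB addrCA subrr addr0.
rewrite enormN kernelE// -mulrDl -/z.
have -> : enorm z `^ (p - s * p) = enorm z `^ 2 * enorm z `^ (p - 2) * enorm z `^ (- (s * p)).
  rewrite -!powRD; [|by apply/implyP => _; rewrite gt_eqF..].
  by congr (_ `^ _); ring.
have k0 : 0 <= enorm z `^ (- (s * p)) / enorm z ^+ n.
  by rewrite divr_ge0 ?powR_ge0 ?exprn_ge0 ?enorm_ge0.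
rewrite -[X in _ * X <= _]mulrA [leLHS]mulrA ler_wpM2r//.
have hz := hv z; have hNz := hv (- z).
rewrite enormN aw wb dotpNr in hz hNz; have {}hz := hz isT; have {}hNz := hNz isT.
set e := K * enorm z ^+ 2 in hz hNz.
have e0 : 0 <= e by rewrite mulr_ge0// exprn_ge0// enorm_ge0.
have s1' := ler_spow p2 hz; have s2' := ler_spow p2 hNz.
have := spow_symm_ge (- dotp q z) p2 e0; rewrite normrN.
rewrite -zE in s1'.
have B : (`|dotp q z| + e) `^ (p - 2) <=
         (enorm q + K * b) `^ (p - 2) * enorm z `^ (p - 2).
  have qKb : 0 <= enorm q + K * b by rewrite addr_ge0 ?enorm_ge0 ?mulr_ge0 ?(ltW b0).
  rewrite -powRM ?enorm_ge0//.
  apply: ge0_ler_powR => //; rewrite ?nnegrE.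
  - by rewrite addr_ge0.
  - by rewrite mulr_ge0 ?enorm_ge0.
  - rewrite mulrDl lerD ?normr_dotp_le// /e expr2 mulrA ler_wpM2r ?enorm_ge0//.
    by rewrite ler_wpM2l// ltW.
have B' : 2 * (p - 1) * e * (`|dotp q z| + e) `^ (p - 2) <=
    2 * (p - 1) * e * ((enorm q + K * b) `^ (p - 2) * enorm z `^ (p - 2)).
  by apply: ler_wpM2l => //; apply: mulr_ge0 => //; apply: mulr_ge0.
have -> : enorm z `^ 2 = enorm z ^+ 2 by rewrite -powR_mulrn// ltW.
have -> : - (2 * ((p - 1) * K * (enorm q + K * b) `^ (p - 2))) * (enorm z ^+ 2 * enorm z `^ (p - 2)) =
   - (2 * (p - 1) * e * ((enorm q + K * b) `^ (p - 2) * enorm z `^ (p - 2))).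
  by rewrite /e; ring.
move: s1' s2' B'; clear; lra.
Qed.

(** The shell is symmetric about [x], so that its integral is half of the integral of the
    sum of the values at two symmetric points; the bound does not depend on the inner
    radius [a]. *)
Lemma shell_integral_ge s p v x q a b K M :
  2 <= p -> 0 < s -> s < 1 -> 0 < a -> 0 < b -> 0 <= K ->
  measurable_fun setT v -> (forall w, `|v w| <= M) ->
  (forall z, a <= enorm z < b -> - dotp q z - K * enorm z ^+ 2 <= v x - v (x + z)) ->
  ((- ((p - 1) * K * (enorm q + K * b) `^ (p - 2) *
      (@radial_const R n (p - s * p) * b `^ (p - s * p))))%:E <=
   \int[mu]_(w in eball x b `\` eball x a) (fplap_integrand s p v x w)%:E)%E.
Proof.
move=> p2 s0 s1 a0 b0 K0 mv vM hv.
have p10 : 0 <= p - 1 by lra.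
have g0 : 0 < p - s * p by nra.
pose c := (p - 1) * K * (enorm q + K * b) `^ (p - 2).
have c0 : 0 <= c by rewrite /c mulr_ge0 ?powR_ge0// mulr_ge0.
pose h w := enorm (w - x) `^ (p - s * p) / enorm (w - x) ^+ n.
have h0 w : 0 <= h w by rewrite divr_ge0 ?powR_ge0 ?exprn_ge0 ?enorm_ge0.
have key w := @fplap_integrand_symm_ge s p v x q a b K w p2 a0 b0 K0 hv.
rewrite -/c in key *.
set S := eball x b `\` eball x a; set I := fplap_integrand s p v x.
have mS : measurable S by apply: measurableD; exact: measurable_eball.
have mI : measurable_fun setT I by exact: measurable_fplap_integrand.
have intI : mu.-integrable S (EFin \o I).
  apply: (@integrableS _ _ _ _ (~` eball x a)) => //.
  - by apply: measurableC; exact: measurable_eball.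
  - by move=> w [].
  - exact: integrable_fplap_integrand vM.
have mh : measurable_fun setT h by exact: measurable_enormB_powR.
have inth : (\int[mu]_(w in S) (h w)%:E <= (@radial_const R n (p - s * p) * b `^ (p - s * p))%:E)%E.
  exact: integral_radial_near.
have inth' : mu.-integrable S (EFin \o h).
  apply/integrableP; split; first by apply/measurable_EFinP; exact: measurable_funTS.
  under eq_integral => w _ do rewrite /= (ger0_norm (h0 w)).
  by apply: le_lt_trans inth _; rewrite ltry.
have symS w : S w <-> S (x + x - w).
  rewrite /S /eball /=.
  by rewrite (_ : x + x - w - x = - (w - x)) ?enormN// opprB addrAC addrK.
have [intIr Ir] := integral_reflection mS mI symS intI.
have intch := integrableZl mS (- (2 * c)) inth'.
have : {in S, forall w, ((- (2 * c))%:E * (h w)%:E <= (I w)%:E + (I (x + x - w))%:E)%E}.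
  move=> w; rewrite inE => -[wb /negP]; rewrite -leNgt => aw.
  rewrite -EFinM -EFinD lee_fin.
  exact: (key w (introT andP (conj aw wb))).
move=> /(le_integral mS intch (integrableD mS intI intIr)).
rewrite [leLHS](integralZl mS inth').
rewrite [leRHS](integralD mS intI intIr).
rewrite [X in (_ <= _ + X)%E]Ir => h1.
have /fineK := integrable_fin_num mS intI; have /fineK := integrable_fin_num mS inth'.
move: inth h1 => /=; set i1 := (\int[mu]_(w in S) (h w)%:E)%E.
set i2 := (\int[mu]_(w in S) (I w)%:E)%E => inth h1 i1E i2E.
move: inth h1; rewrite -i1E -i2E -EFinM -EFinD !lee_fin => inth h1.
have : c * fine i1 <= c * (@radial_const R n (p - s * p) * b `^ (p - s * p)).
  by rewrite ler_wpM2l.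
rewrite -/c; move: h1; clear; lra.
Qed.

End integrand.

Section principal_value.
Context {R : realType} {n : nat}.
Implicit Types (x w z q : 'rV[R]_n) (v : 'rV[R]_n -> R) (s p M K : R).
Local Notation mu := (@lebesgue_rV R n).

Lemma fplap_truncE s p v x eps : fplap_trunc s p v x eps =
  (\int[mu]_(w in ~` eball x eps) (fplap_integrand s p v x w)%:E)%E.
Proof. by []. Qed.

Lemma fplap_truncN s p v x M eps :
  2 <= p -> 0 < s -> 0 < eps -> measurable_fun setT v -> (forall w, `|v w| <= M) ->
  fplap_trunc s p (fun w => - v w) x eps = (- fplap_trunc s p v x eps)%E.
Proof.
move=> p2 s0 e0 mv vM; rewrite !fplap_truncE.
have mD : measurable (~` eball x eps) by apply: measurableC; exact: measurable_eball.
have intI := integrable_fplap_integrand x p2 s0 e0 mv vM.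
have -> : (\int[mu]_(w in ~` eball x eps) (fplap_integrand s p (fun w => - v w) x w)%:E =
  \int[mu]_(w in ~` eball x eps) ((-1)%:E * (fplap_integrand s p v x w)%:E))%E.
  apply: eq_integral => w _; rewrite -EFinM /fplap_integrand -opprD spowN.
  by rewrite mulN1r mulNr.
by rewrite (integralZl mD intI) mulN1e.
Qed.

(** The growth exponent is [gam / (p - 1)], so that the power [p - 1] of the growth is
    absorbed by the decay of the kernel when [gam < s * p].  The set [E] carries the gain:
    it is where [v] lies at least [a] below [v x]. *)
Lemma far_integral_ge s p v x M r d a m e gam (E : set 'rV[R]_n) :
  2 <= p -> 0 < s -> 0 < r -> 0 <= a -> 0 <= d -> 0 <= e -> 0 < gam < s * p ->
  measurable_fun setT v -> (forall w, `|v w| <= M) ->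
  (forall w, r <= enorm (w - x) ->
     - (e * (enorm (w - x) / r) `^ (gam / (p - 1))) <= v x - v w) ->
  measurable E -> (forall w, E w -> r <= enorm (w - x) <= d) ->
  (forall w, E w -> a <= v x - v w) -> (m%:E <= mu E)%E ->
  ((a `^ (p - 1) * d `^ (- (s * p)) / d ^+ n * m -
     e `^ (p - 1) * (@radial_const R n (- (s * p - gam)) * r `^ (- (s * p))))%:E <=
   \int[mu]_(w in ~` eball x r) (fplap_integrand s p v x w)%:E)%E.
Proof.
move=> p2 s0 r0 a0 d0 e0 /andP[gam0 gams] mv vM far mE Erd Ea mE_ge.
set D := ~` eball x r; set I := fplap_integrand s p v x.
have mD : measurable D by apply: measurableC; exact: measurable_eball.
have mI : measurable_fun setT I by exact: measurable_fplap_integrand.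
have intI : mu.-integrable D (EFin \o I) by exact: integrable_fplap_integrand vM.
pose c := e `^ (p - 1) * r `^ (- gam).
have c0 : 0 <= c by rewrite mulr_ge0 ?powR_ge0.
pose h w := enorm (w - x) `^ (- (s * p - gam)) / enorm (w - x) ^+ n.
have h0 w : 0 <= h w by rewrite divr_ge0 ?powR_ge0 ?exprn_ge0 ?enorm_ge0.
have mh : measurable_fun setT h by exact: measurable_enormB_powR.
have hint : (\int[mu]_(w in D) (h w)%:E <=
    (@radial_const R n (- (s * p - gam)) * r `^ (- (s * p - gam)))%:E)%E.
  by apply: integral_radial_far => //; lra.
have inth : mu.-integrable D (EFin \o h).
  apply/integrableP; split; first by apply/measurable_EFinP; exact: measurable_funTS.
  under eq_integral => w _ do rewrite /= ger0_norm//.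
  by apply: le_lt_trans hint _; rewrite ltry.
have intch := integrableZl mD c inth.
pose b := a `^ (p - 1) * d `^ (- (s * p)) / d ^+ n.
have lower w : D w -> (b%:E * (\1_E w)%:E <= (I w)%:E + c%:E * (h w)%:E)%E.
  rewrite /D /eball /= => /negP; rewrite -leNgt => rw.
  rewrite -!EFinM -EFinD lee_fin.
  have w0 : 0 < enorm (w - x) by exact: lt_le_trans rw.
  have t0 : 0 < enorm (w - x) / r by rewrite divr_gt0.
  rewrite /I /fplap_integrand (enormB x w) kernelE//.
  have k0 : 0 <= enorm (w - x) `^ (- (s * p)) / enorm (w - x) ^+ n.
    by rewrite divr_ge0 ?powR_ge0 ?exprn_ge0 ?enorm_ge0.
  have ch0 : 0 <= c * h w by rewrite mulr_ge0.
  have [wE|wE] := pselect (E w).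
    rewrite indicE mem_set// mulr1.
    have /andP[_ wd] := Erd w wE.
    have {}d0 : 0 < d by exact: lt_le_trans wd.
    apply: ler_wpDr => //; rewrite /b -mulrA; apply: ler_pM.
    - exact: powR_ge0.
    - by rewrite divr_ge0 ?powR_ge0 ?exprn_ge0 ?(ltW d0).
    - by rewrite -spowE//; apply: ler_spow => //; exact: Ea.
    - apply: ler_pM; rewrite ?powR_ge0 ?invr_ge0 ?exprn_ge0 ?(ltW d0)//.
        rewrite !powRN lef_pV2 ?posrE ?powR_gt0//.
        by apply: ge0_ler_powR; rewrite ?nnegrE ?(ltW d0) ?(ltW w0)//; nra.
      by rewrite lef_pV2 ?posrE ?exprn_gt0// lerXn2r ?nnegrE ?(ltW d0) ?(ltW w0).
  rewrite indicE memNset// mulr0.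
  have -> : c * h w = (e * (enorm (w - x) / r) `^ (gam / (p - 1))) `^ (p - 1) *
      (enorm (w - x) `^ (- (s * p)) / enorm (w - x) ^+ n).
    rewrite [(e * _) `^ _]powRM ?powR_ge0// -powRrM divfK; last by rewrite gt_eqF//; lra.
    rewrite /c /h powRM ?invr_ge0 ?(ltW w0) ?(ltW r0)//.
    have -> : - (s * p - gam) = - (s * p) + gam by ring.
    rewrite (@powRD _ (enorm (w - x))); last by apply/implyP => _; rewrite gt_eqF.
    by rewrite -(@powR_inv1 _ r) ?(ltW r0)// -powRrM mulN1r; ring.
  rewrite -mulrDl mulr_ge0//.
  have := ler_spow p2 (far w rw).
  rewrite spowN spowE//; last by rewrite mulr_ge0 ?powR_ge0.
  lra.
have b0 : 0 <= b by rewrite /b !mulr_ge0 ?powR_ge0 ?invr_ge0 ?exprn_ge0.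
have key : ((b * m)%:E <= \int[mu]_(w in D) ((I w)%:E + c%:E * (h w)%:E))%E.
  apply: (@le_trans _ _ (\int[mu]_(w in D) (b%:E * (\1_E w)%:E)))%E.
    rewrite ge0_integralZl_EFin//; last first.
      by apply: measurable_funTS; apply/measurable_EFinP; exact: measurable_indic.
    rewrite integral_indic// (_ : E `&` D = E).
      by rewrite EFinM lee_wpmul2l.
    apply/setIidPl => w /Erd /andP[rw _]; rewrite /D /eball /=; apply/negP.
    by rewrite -leNgt.
  apply: ge0_le_integral => //.
  - by move=> w _; rewrite -EFinM lee_fin mulr_ge0.
  - apply: emeasurable_funM; first exact: measurable_cst.
    by apply: measurable_funTS; apply/measurable_EFinP; exact: measurable_indic.
  - apply: emeasurable_funD.
      by apply/measurable_EFinP; exact: measurable_funTS.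
    apply: emeasurable_funM; first exact: measurable_cst.
    by apply/measurable_EFinP; exact: measurable_funTS.
move: key; rewrite integralD// (integralZl mD inth).
have /fineK := integrable_fin_num mD intI; have /fineK := integrable_fin_num mD inth.
move: hint => /=; set i1 := (\int[mu]_(w in D) (h w)%:E)%E.
set i2 := (\int[mu]_(w in D) (I w)%:E)%E => hint i1E i2E.
move: hint; rewrite -i1E -i2E -EFinM -EFinD !lee_fin => hint key.
have : c * fine i1 <= c * (@radial_const R n (- (s * p - gam)) * r `^ (- (s * p - gam))).
  by rewrite ler_wpM2l.
have -> : c * (@radial_const R n (- (s * p - gam)) * r `^ (- (s * p - gam))) =
  e `^ (p - 1) * (@radial_const R n (- (s * p - gam)) * r `^ (- (s * p))).
  have -> : - (s * p) = - gam + - (s * p - gam) by ring.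
  rewrite (@powRD _ r (- gam)); last by apply/implyP => _; rewrite gt_eqF.
  by rewrite /c; ring.
move: key; rewrite /b; lra.
Qed.

(** The ball of radius [r2] is split at the radius [r1] because a quadratic bound with good
    constants may hold only away from [x], while close to [x] the only bound comes from
    the local regularity, with constants that are not controlled. *)
Lemma fplap_lower_bound s p v x G M r1 r2 q1 q2 K1 K2 d a m e gam (E : set 'rV[R]_n) :
  2 <= p -> 0 < s -> s < 1 -> 0 < r1 -> r1 <= r2 -> 0 <= K1 -> 0 <= K2 ->
  0 <= a -> 0 <= d -> 0 <= e -> 0 < gam < s * p ->
  measurable_fun setT v -> (forall w, `|v w| <= M) ->
  fplap_trunc s p v x eps @[eps --> 0^'+] --> G%:E ->
  (forall z, enorm z < r1 -> - dotp q1 z - K1 * enorm z ^+ 2 <= v x - v (x + z)) ->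
  (forall z, r1 <= enorm z < r2 ->
     - dotp q2 z - K2 * enorm z ^+ 2 <= v x - v (x + z)) ->
  (forall w, r2 <= enorm (w - x) ->
     - (e * (enorm (w - x) / r2) `^ (gam / (p - 1))) <= v x - v w) ->
  measurable E -> (forall w, E w -> r2 <= enorm (w - x) <= d) ->
  (forall w, E w -> a <= v x - v w) -> (m%:E <= mu E)%E ->
  a `^ (p - 1) * d `^ (- (s * p)) / d ^+ n * m <= G
  + (p - 1) * K1 * (enorm q1 + K1 * r1) `^ (p - 2) *
      (@radial_const R n (p - s * p) * r1 `^ (p - s * p))
  + (p - 1) * K2 * (enorm q2 + K2 * r2) `^ (p - 2) *
      (@radial_const R n (p - s * p) * r2 `^ (p - s * p))
  + e `^ (p - 1) * (@radial_const R n (- (s * p - gam)) * r2 `^ (- (s * p))).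
Proof.
move=> p2 s0 s1 r10 r12 K10 K20 a0 d0 e0 gam0 mv vM cvgG near1 near2 far mE Erd Ea mEge.
have r20 : 0 < r2 by exact: lt_le_trans r12.
have B3 := far_integral_ge p2 s0 r20 a0 d0 e0 gam0 mv vM far mE Erd Ea mEge.
have B2 := shell_integral_ge p2 s0 s1 r10 r20 K20 mv vM near2.
set b1 := (p - 1) * K1 * _ * _; set b2 := (p - 1) * K2 * _ * _ in B2 *.
set b3 := e `^ (p - 1) * _ in B3 *; set g := a `^ (p - 1) * _ / _ * _ in B3 *.
rewrite -(@lee_fin R) in B2 *.
suff : ((g - b3 - b2 - b1)%:E <= G%:E)%E by rewrite !lee_fin; lra.
apply: (cvge_ge _ cvgG).
near=> eps.
have eps0 : 0 < eps by near: eps; exact: nbhs_right_gt.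
have epsr : eps < r1 by near: eps; exact: nbhs_right_lt.
have near1' z : eps <= enorm z < r1 -> - dotp q1 z - K1 * enorm z ^+ 2 <= v x - v (x + z).
  by move=> /andP[_]; exact: near1.
have B1 := shell_integral_ge p2 s0 s1 eps0 r10 K10 mv vM near1'.
rewrite -/b1 in B1.
have mb r : measurable (eball x r) by exact: measurable_eball.
have mI A : measurable_fun A (fun w => (fplap_integrand s p v x w)%:E).
  by apply/measurable_EFinP; apply: measurable_funTS; exact: measurable_fplap_integrand.
have split r r' : r <= r' -> (\int[mu]_(w in ~` eball x r) (fplap_integrand s p v x w)%:E =
   \int[mu]_(w in ~` eball x r') (fplap_integrand s p v x w)%:E +
   \int[mu]_(w in eball x r' `\` eball x r) (fplap_integrand s p v x w)%:E)%E.
  move=> rr'; rewrite -integral_setU.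
  - congr (integral _ _ _); rewrite /eball; apply/seteqP; split => w /=.
      move=> /negP; rewrite -leNgt => rw; have [h|h] : (enorm (w - x) < r')%R \/ (r' <= enorm (w - x))%R.
        by apply/orP; case: ltP.
        by right; split => //= hlt; have := le_lt_trans rw hlt; rewrite ltxx.
      by left; apply/negP; rewrite -leNgt.
    by move=> [|[_]//] /= nw wr; apply: nw; exact: lt_le_trans rr'.
  - exact: measurableC.
  - exact: measurableD.
  - exact: mI.
  - by apply/disj_setPS => w [/= nw [/nw]].
rewrite fplap_truncE (split eps r1 (ltW epsr)) (split r1 r2 r12).
apply: (@le_trans _ _ ((g - b3)%:E + (- b2)%:E + (- b1)%:E)%E).
  by rewrite -!EFinD.
by apply: leeD => //; apply: leeD.
Unshelve. all: by end_near.
Qed.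

End principal_value.

Lemma powR_small (R : realType) (g eps : R) : 0 < g -> 0 < eps ->
  exists2 t0 : R, 0 < t0 & forall t, 0 <= t <= t0 -> t `^ g <= eps.
Proof.
move=> g0 e0; exists (eps `^ g^-1); first exact: powR_gt0.
move=> t /andP[t0 tle].
have := @ge0_ler_powR R g (ltW g0) t (eps `^ g^-1).
rewrite !nnegrE t0 powR_ge0 -powRrM mulVf ?gt_eqF// powRr1 ?(ltW e0)//.
exact.
Qed.

Lemma powR_small_mul (R : realType) (g c eps : R) : 0 < g -> 0 <= c -> 0 < eps ->
  exists2 t0 : R, 0 < t0 & forall t, 0 <= t <= t0 -> c * t `^ g <= eps.
Proof.
move=> g0 c0 e0; have c1 : 0 < c + 1 by lra.
have [t0 t00 H] := powR_small g0 (divr_gt0 e0 c1); exists t0 => // t tt.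
have := H t tt; rewrite ler_pdivlMr// => h.
by have := powR_ge0 t g; nra.
Qed.

(** * Functions touched from above *)

Section touching.
Context {R : realType} {n : nat}.
Implicit Types (x w z q : 'rV[R]_n) (v : 'rV[R]_n -> R).
Local Notation mu := (@lebesgue_rV R n).

(** The part of [C^{1,1}] regularity that the estimate needs: paraboloids that touch [v] from
    above at all points near [x], with constants that do not depend on the point. *)
Definition locally_below_paraboloid v x := exists d Q K : R,
  [/\ 0 < d, 0 <= Q, 0 <= K & forall y, enorm (y - x) < d ->
    exists2 q, enorm q <= Q & forall z, enorm z < d ->
      - dotp q z - K * enorm z ^+ 2 <= v y - v (y + z)].

(** An inequality that is known almost everywhere, hence at points arbitrarily close to [x]. *)
Definition fplap_le_near s p v (N : R) x := forall e : R, 0 < e ->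
  exists2 y, enorm (y - x) < e &
  exists2 G : R, G <= N & fplap_trunc s p v y eps @[eps --> 0^'+] --> G%:E.

(** A quadratic bound at [x] persists at [x + h] outside of a ball of radius [r], at the
    price of a factor 3, as soon as [h] and the loss [t] are small with respect to [r]. *)
Lemma transported_quadratic_bound v x h q z K t r :
  0 <= K -> r <= enorm z -> 0 <= r ->
  t + enorm q * enorm h + 2 * K * enorm h ^+ 2 <= K * r ^+ 2 ->
  - t <= v (x + h) - v x ->
  (forall w, - dotp q (w - x) - K * enorm (w - x) ^+ 2 <= v x - v w) ->
  - dotp q z - (3 * K) * enorm z ^+ 2 <= v (x + h) - v (x + h + z).
Proof.
move=> K0 rz r0 tK ht hq.
have := hq (x + h + z).
rewrite (_ : x + h + z - x = h + z); last by rewrite addrAC (addrC x) addrK addrC.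
rewrite dotpDr.
have sq : enorm (h + z) ^+ 2 <= 2 * enorm h ^+ 2 + 2 * enorm z ^+ 2.
  apply: (@le_trans _ _ ((enorm h + enorm z) ^+ 2)).
    by rewrite lerXn2r ?nnegrE ?addr_ge0 ?enorm_ge0// enormD.
  by have := sqr_ge0 (enorm h - enorm z); nra.
have zr : r ^+ 2 <= enorm z ^+ 2 by rewrite lerXn2r ?nnegrE ?enorm_ge0.
have qh := dotp_le q h.
have := ler_wpM2l K0 sq; have := ler_wpM2l K0 zr.
move: tK ht qh; lra.
Qed.

Lemma transported_growth (x y w : 'rV[R]_n) (rho th sg : R) :
  0 < rho -> 0 < th <= 1 -> 0 < sg <= 1 -> enorm (y - x) <= rho ->
  th * rho <= enorm (w - y) ->
  (1 + enorm (w - x) / rho) `^ sg <= 3 * (enorm (w - y) / (th * rho)) `^ sg.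
Proof.
move=> rho0 /andP[th0 th1] /andP[sg0 sg1] yx wy.
have tr0 : 0 < th * rho by rewrite mulr_gt0.
have u1 : 1 <= enorm (w - y) / (th * rho) by rewrite ler_pdivlMr// mul1r.
have B : 1 + enorm (w - x) / rho <= 3 * (enorm (w - y) / (th * rho)).
  have h1 := enorm_distD y w x.
  have h2 : enorm (w - x) / rho <= enorm (w - y) / rho + 1.
    by rewrite ler_pdivrMr// mulrDl divfK ?gt_eqF// mul1r; lra.
  have h3 : enorm (w - y) / rho <= enorm (w - y) / (th * rho).
    rewrite ler_wpM2l ?enorm_ge0// lef_pV2 ?posrE//.
    by rewrite ler_piMl// ltW.
  lra.
apply: (@le_trans _ _ ((3 * (enorm (w - y) / (th * rho))) `^ sg)).
  have a0 : 0 <= enorm (w - x) / rho by rewrite divr_ge0 ?enorm_ge0 ?(ltW rho0).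
  by apply: ge0_ler_powR; rewrite ?nnegrE; lra.
rewrite powRM//; last by lra.
by rewrite ler_wpM2r ?powR_ge0// ler1_powR//; lra.
Qed.

(** All the terms of the estimate have the homogeneity of
    [A `^ (p - 1) * rho `^ (- (s * p))]; this lemma and the next two extract this factor. *)
Lemma gain_scaling (p g A rho m0 : R) : 0 < A -> 0 < rho ->
  (A / 4) `^ (p - 1) * (5 * rho) `^ (- g) / (5 * rho) ^+ n * (m0 * rho ^+ n) =
  (4^-1 `^ (p - 1) * 5 `^ (- g) / 5 ^+ n * m0) * (A `^ (p - 1) * rho `^ (- g)).
Proof.
move=> A0 r0; rewrite !powRM ?(ltW A0) ?(ltW r0) ?invr_ge0// exprMn.
have rn : rho ^+ n != 0 by rewrite gt_eqF// exprn_gt0.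
have fn : 5 ^+ n != 0 :> R by rewrite gt_eqF// exprn_gt0.
by field; rewrite rn fn.
Qed.

Lemma near_loss_scaling (p g K0 A rho th q C : R) : 2 <= p -> 0 < A -> 0 < rho ->
  0 < K0 -> 0 < th <= 1 -> 0 <= C -> 0 <= q -> q <= K0 * A / rho ->
  (p - 1) * (3 * (K0 * A / rho ^+ 2)) *
    (q + 3 * (K0 * A / rho ^+ 2) * (th * rho)) `^ (p - 2) *
    (C * (th * rho) `^ (p - g)) <=
  (p - 1) * (3 * K0) * (4 * K0) `^ (p - 2) * C * th `^ (p - g) *
    (A `^ (p - 1) * rho `^ (- g)).
Proof.
move=> p2 A0 r0 K00 /andP[th0 th1] C0 q0 qle.
have r0' : rho != 0 by rewrite gt_eqF.
have KA0 : 0 <= K0 * A / rho ^+ 2.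
  by rewrite divr_ge0 ?exprn_ge0 ?mulr_ge0 ?(ltW A0) ?(ltW r0) ?(ltW K00).
have B : q + 3 * (K0 * A / rho ^+ 2) * (th * rho) <= 4 * K0 * (A / rho).
  have -> : 3 * (K0 * A / rho ^+ 2) * (th * rho) = 3 * th * (K0 * A / rho) by field.
  have : 0 <= K0 * A / rho by rewrite divr_ge0 ?mulr_ge0 ?ltW.
  by move: th1 qle; nra.
have {}B : (q + 3 * (K0 * A / rho ^+ 2) * (th * rho)) `^ (p - 2) <=
    (4 * K0) `^ (p - 2) * (A `^ (p - 2) * rho `^ (- (p - 2))).
  have AE : A `^ (p - 2) * rho `^ (- (p - 2)) = (A / rho) `^ (p - 2).
    rewrite powRM ?invr_ge0 ?(ltW A0) ?(ltW r0)//.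
    by rewrite -(@powR_inv1 _ rho) ?(ltW r0)// -powRrM mulN1r.
  rewrite AE -powRM; [|by rewrite mulr_ge0 ?ltW|by rewrite divr_ge0 ?ltW].
  apply: ge0_ler_powR => //; rewrite ?nnegrE.
  - by rewrite subr_ge0.
  - apply: addr_ge0 => //; apply: mulr_ge0; first exact: mulr_ge0.
    by rewrite mulr_ge0// ltW.
  - by rewrite !mulr_ge0 ?invr_ge0 ?(ltW A0) ?(ltW r0) ?(ltW K00).
have p10 : 0 <= p - 1 by lra.
apply: (@le_trans _ _ ((p - 1) * (3 * (K0 * A / rho ^+ 2)) *
   ((4 * K0) `^ (p - 2) * (A `^ (p - 2) * rho `^ (- (p - 2)))) *
    (C * (th * rho) `^ (p - g)))).
  apply: ler_wpM2r; first by rewrite mulr_ge0 ?powR_ge0.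
  by apply: ler_wpM2l B; apply: mulr_ge0 => //; apply: mulr_ge0.
rewrite (@powRM _ th rho) ?(ltW th0) ?(ltW r0)//.
have -> : A `^ (p - 1) = A * A `^ (p - 2).
  rewrite -(@mulr_powRB1 _ A (p - 1)) ?(ltW A0)//; last by lra.
  by congr (_ * _ `^ _); ring.
have -> : rho `^ (- g) = rho ^- 2 * rho `^ (- (p - 2)) * rho `^ (p - g).
  rewrite -powR_invn ?(ltW r0)// -!powRD; try by apply/implyP.
  by congr (_ `^ _); ring.
rewrite le_eqVlt; apply/orP; left; apply/eqP.
by field.
Qed.

Lemma far_loss_scaling (p g A rho th k C : R) : 0 < A -> 0 < rho -> 0 < th -> 0 < k ->
  (4 * A * k) `^ (p - 1) * (C * (th * rho) `^ (- g)) =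
  C * 4 `^ (p - 1) * th `^ (- g) * k `^ (p - 1) * (A `^ (p - 1) * rho `^ (- g)).
Proof.
move=> A0 r0 th0 k0; rewrite !powRM ?mulr_ge0 ?(ltW A0) ?(ltW r0) ?(ltW th0) ?(ltW k0)//.
by ring.
Qed.

(** The content of [touching_estimate], isolated because the constants [c] and [k0] must be
    known before the exponent is chosen. *)
Definition touching_property (s p K0 m0 c k0 : R) :=
  forall v x q (rho A N M k : R) (E : set 'rV[R]_n),
    0 < rho -> 0 < A -> 0 < k <= k0 ->
    measurable_fun setT v -> (forall w, `|v w| <= M) ->
    locally_below_paraboloid v x -> fplap_le_near s p v N x ->
    enorm q <= K0 * A / rho ->
    (forall w, - dotp q (w - x) - K0 * A / rho ^+ 2 * enorm (w - x) ^+ 2 <= v x - v w) ->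
    (forall w, - (A * (k * (1 + enorm (w - x) / rho) `^ (s * p / 2 / (p - 1))))
       <= v x - v w) ->
    measurable E -> (forall w, E w -> rho / 4 <= enorm (w - x) <= 4 * rho) ->
    (forall w, E w -> A / 3 <= v x - v w) -> ((m0 * rho ^+ n)%:E <= mu E)%E ->
    c * (A `^ (p - 1) * rho `^ (- (s * p))) <= N.

(** The radius [th * rho] separates the near part from the far part: [th] is chosen first,
    so that the near loss is a quarter of the gain, then [k0], for the far loss, and at
    last, depending on [v] and [x], the radius [r1] below which only the local regularity
    is used and the distance from [x] to the point at which the equation is read. *)
Lemma touching_estimate (s p K0 m0 : R) :
  2 <= p -> 0 < s -> s < 1 -> 0 < K0 -> 0 < m0 ->
  exists c k0 : R, [/\ 0 < c, 0 < k0 & touching_property s p K0 m0 c k0].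
Proof.
move=> p2 s0 s1 K00 m00.
have p10 : 0 < p - 1 by lra.
have sp0 : 0 < s * p by nra.
have psp : 0 < p - s * p by nra.
set sg := s * p / 2 / (p - 1).
have sg01 : 0 < sg <= 1.
  rewrite /sg divr_gt0 ?divr_gt0//= ler_pdivrMr// ler_pdivrMr//; nra.
pose C1 := @radial_const R n (p - s * p).
pose C3 := @radial_const R n (- (s * p - s * p / 2)).
have C10 : 0 <= C1 by exact: radial_const_ge0.
have C30 : 0 <= C3 by exact: radial_const_ge0.
pose cg := 4^-1 `^ (p - 1) * 5 `^ (- (s * p)) / 5 ^+ n * m0.
have cg0 : 0 < cg by rewrite /cg !mulr_gt0 ?powR_gt0 ?invr_gt0 ?exprn_gt0.
have cg4 : 0 < cg / 4 by rewrite divr_gt0.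
pose C2 := (p - 1) * (3 * K0) * (4 * K0) `^ (p - 2) * C1.
have C20 : 0 <= C2 by rewrite /C2; apply: mulr_ge0 => //; apply: mulr_ge0; [nra|exact: powR_ge0].
have [th1 th10 Hth] := powR_small_mul psp C20 cg4.
pose th := Num.min (8^-1) th1.
have th0 : 0 < th by rewrite /th lt_min th10 invr_gt0 ltr0n.
have th8 : th <= 8^-1 by rewrite /th ge_min lexx.
have {}Hth : C2 * th `^ (p - s * p) <= cg / 4.
  by apply: Hth; rewrite (ltW th0) /th ge_min lexx orbT.
have D30 : 0 <= C3 * 4 `^ (p - 1) * th `^ (- (s * p)) by apply: mulr_ge0; [apply: mulr_ge0|]; rewrite ?powR_ge0.
have [k0 k00 Hk] := powR_small_mul p10 D30 cg4.
exists (cg / 4), k0; split => // v x q rho A N M k E rho0 A0 /andP[kpos kk0] mv vM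
  [d1 [Q1 [K1 [d10 Q10 K10 lq]]]] good qle near far mE Erho EA mEge.
have {}Hk : C3 * 4 `^ (p - 1) * th `^ (- (s * p)) * k `^ (p - 1) <= cg / 4.
  by apply: Hk; rewrite (ltW kpos).
pose X := A `^ (p - 1) * rho `^ (- (s * p)).
have X0 : 0 < X by rewrite mulr_gt0 ?powR_gt0.
have D10 : 0 <= (p - 1) * K1 * (Q1 + K1) `^ (p - 2) * C1.
  by apply: mulr_ge0 => //; apply: mulr_ge0; [nra|exact: powR_ge0].
have [t1 t10 Ht1] := powR_small_mul psp D10 (mulr_gt0 cg4 X0).
pose r2 := th * rho; have r20 : 0 < r2 by rewrite mulr_gt0.
pose r1 := Num.min (Num.min r2 d1) (Num.min 1 t1).
have r10 : 0 < r1 by rewrite /r1 !lt_min r20 d10 t10 ltr01.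
have r12 : r1 <= r2 by rewrite /r1 !ge_min lexx.
have r1d : r1 <= d1 by rewrite /r1 !ge_min lexx orbT.
have r11 : r1 <= 1 by rewrite /r1 !ge_min lexx !orbT.
have {}Ht1 : (p - 1) * K1 * (Q1 + K1) `^ (p - 2) * C1 * r1 `^ (p - s * p) <= cg / 4 * X.
  by apply: Ht1; rewrite (ltW r10) /r1 !ge_min lexx !orbT.
pose K := K0 * A / rho ^+ 2.
have Kpos : 0 < K by rewrite divr_gt0 ?mulr_gt0 ?exprn_gt0.
(* all the requirements on the distance from [x] to the good point *)
have [e0 e00 He] : exists2 e : R, 0 < e & [/\ e <= d1, e <= rho / 8, e <= 1 &
    (Q1 + K1 + enorm q + 2 * K) * e <= Num.min (K * r1 ^+ 2) (Num.min (A * k) (A / 12))].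
  pose B := Num.min (K * r1 ^+ 2) (Num.min (A * k) (A / 12)).
  have B0 : 0 < B.
    rewrite /B !lt_min; apply/and3P; split; last by rewrite divr_gt0.
      by rewrite mulr_gt0// exprn_gt0.
    by rewrite mulr_gt0.
  pose S := Q1 + K1 + enorm q + 2 * K + 1.
  have S0 : 0 < S by rewrite /S; have := enorm_ge0 q; move: Q10 K10 Kpos; clear; lra.
  exists (Num.min (Num.min d1 (rho / 8)) (Num.min 1 (B / S))).
    by rewrite !lt_min d10 ltr01 !divr_gt0.
  split; [by rewrite !ge_min lexx|by rewrite !ge_min lexx orbT|
          by rewrite !ge_min lexx !orbT|].
  set e := Num.min _ _; have eBS : e <= B / S by rewrite /e !ge_min lexx !orbT.
  have e_ge0 : 0 <= e by rewrite /e !le_min !(ltW d10) !divr_ge0 ?ler01 ?(ltW B0) ?(ltW S0) ?(ltW rho0).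
  move: eBS; rewrite ler_pdivlMr// -/B /S mulrDr mulr1 mulrC; move: e_ge0; clear; lra.
have [ed1 erho e1 eB] := He.
have [y yx [G GN cvgG]] := good e0 e00.
pose h := y - x; have yE : y = x + h by rewrite /h addrCA subrr addr0.
have h_ge0 := enorm_ge0 h.
have he0 : enorm h <= e0 by exact: ltW.
have [q1 q1Q near1] := lq y (lt_le_trans yx ed1).
pose t := (Q1 + K1) * enorm h.
have vt : - t <= v (x + h) - v x.
  have := near1 (- h).
  rewrite enormN yE addrK => /(_ (lt_le_trans yx ed1)).
  rewrite dotpNr opprK; have := dotp_le q1 (- h); rewrite dotpNr enormN.
  have : enorm h ^+ 2 <= enorm h by rewrite expr2 ler_piMr//; move: he0 e1; clear; lra.
  have : enorm q1 * enorm h <= Q1 * enorm h by rewrite ler_wpM2r.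
  have : forall a b : R, 0 <= K1 -> a <= b -> K1 * a <= K1 * b by move=> a b k' ab; rewrite ler_wpM2l.
  move=> /[swap] h1 /(_ _ _ K10) h2 h3 h4 h5.
  have := h2 _ _ h3.
  move: h1 h4 h5; rewrite /t mulrDl; clear; lra.
have [tK tAk tA] : [/\ t + enorm q * enorm h + 2 * K * enorm h ^+ 2 <= K * r1 ^+ 2,
    t <= A * k & t <= A / 12].
  have : enorm h ^+ 2 <= enorm h by rewrite expr2 ler_piMr//; move: he0 e1; clear; lra.
  move: eB; rewrite !le_min => /and3P[e1' e2' e3'] h2.
  have q0 := enorm_ge0 q.
  have hK := ler_wpM2l (ltW Kpos) h2.
  have he := ler_wpM2l (_ : 0 <= Q1 + K1 + enorm q + 2 * K) he0.
  have {}he : (Q1 + K1 + enorm q + 2 * K) * enorm h <= (Q1 + K1 + enorm q + 2 * K) * e0.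
    by apply: he; move: Q10 K10 q0 Kpos; clear; lra.
  have t0 : 0 <= t by rewrite /t mulr_ge0// addr_ge0.
  have qh0 : 0 <= enorm q * enorm h by rewrite mulr_ge0.
  have Kh0 : 0 <= K * enorm h by rewrite mulr_ge0// ltW.
  move: he hK; rewrite !mulrDl -/t => he hK.
  split; move: he hK t0 qh0 Kh0 e1' e2' e3'; rewrite /t !mulrDl; clear; lra.
have near2 z : r1 <= enorm z < r2 ->
    - dotp q z - 3 * K * enorm z ^+ 2 <= v y - v (y + z).
  move=> /andP[rz _]; rewrite yE.
  exact: (transported_quadratic_bound (ltW Kpos) rz (ltW r10) tK vt near).
have far' w : r2 <= enorm (w - y) ->
    - (4 * A * k * (enorm (w - y) / r2) `^ (s * p / 2 / (p - 1))) <= v y - v w.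
  move=> rw; have hr : enorm (y - x) <= rho by rewrite -/h; move: he0 erho rho0; clear; lra.
  have th01 : 0 < th <= 1 by rewrite th0; move: th8; clear; lra.
  have := transported_growth rho0 th01 sg01 hr rw; rewrite -/r2 => gr.
  have := far w; rewrite -/sg yE => fw.
  have u1 : 1 <= (enorm (w - y) / r2) `^ sg.
    have u : 1 <= enorm (w - y) / r2 by rewrite ler_pdivlMr// mul1r.
    case/andP: sg01 => sgp _; have := @ge0_ler_powR R sg (ltW sgp) 1 (enorm (w - y) / r2).
    by rewrite powR1 !nnegrE ler01 (le_trans _ u)//; apply.
  have Ak : 0 < A * k by rewrite mulr_gt0.
  have := ler_wpM2l (ltW Ak) gr; have := ler_wpM2l (ltW Ak) u1.
  by rewrite -yE in vt *; move: tAk vt fw; clear; lra.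
have Erd w : E w -> r2 <= enorm (w - y) <= 5 * rho.
  move=> /Erho /andP[h1 h2].
  have d1' := enorm_distD y w x; have d2 := enorm_distD x w y.
  rewrite (enormB x y) -/h in d2; rewrite -/h in d1'.
  have : r2 <= rho / 8 by rewrite /r2 mulrC ler_wpM2l// ltW.
  by move: h1 h2 d1' d2 he0 erho rho0; clear => *; apply/andP; split; lra.
have Ea w : E w -> A / 4 <= v y - v w.
  by move=> /EA; rewrite yE; move: vt tA; clear; lra.
have gam0 : 0 < s * p / 2 < s * p by move: sp0; clear => *; apply/andP; split; lra.
have near1' z : enorm z < r1 -> - dotp q1 z - K1 * enorm z ^+ 2 <= v y - v (y + z).
  by move=> zr; apply: near1; exact: lt_le_trans r1d.
have K3 : 0 <= 3 * K by rewrite mulr_ge0// ltW.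
have a0 : 0 <= A / 4 by rewrite divr_ge0// ltW.
have d0 : 0 <= 5 * rho by rewrite mulr_ge0// ltW.
have e0' : 0 <= 4 * A * k by rewrite !mulr_ge0// ltW.
have := fplap_lower_bound p2 s0 s1 r10 r12 K10 K3 a0 d0 e0' gam0 mv vM cvgG near1' near2
  far' mE Erd Ea mEge.
rewrite -/C1 -/C3 gain_scaling// -/cg far_loss_scaling// -/X.
have th01 : 0 < th <= 1 by rewrite th0; move: th8; clear; lra.
have := @near_loss_scaling p (s * p) K0 A rho th (enorm q) C1 p2 A0 rho0 K00 th01 C10 (enorm_ge0 q) qle.
rewrite -/K -/r2 -/C2 -/X.
have b1 : (p - 1) * K1 * (enorm q1 + K1 * r1) `^ (p - 2) * (C1 * r1 `^ (p - s * p)) <= cg / 4 * X.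
  apply: le_trans Ht1.
  have reorder Y : (p - 1) * K1 * Y * (C1 * r1 `^ (p - s * p)) =
    (p - 1) * K1 * C1 * r1 `^ (p - s * p) * Y by ring.
  have -> : (p - 1) * K1 * (Q1 + K1) `^ (p - 2) * C1 * r1 `^ (p - s * p) =
    (p - 1) * K1 * C1 * r1 `^ (p - s * p) * (Q1 + K1) `^ (p - 2) by ring.
  rewrite reorder; apply: ler_wpM2l.
    apply: mulr_ge0; last exact: powR_ge0.
    by apply: mulr_ge0 => //; apply: mulr_ge0 => //; exact: ltW.
  apply: ge0_ler_powR; rewrite ?nnegrE ?subr_ge0//.
  - by rewrite addr_ge0 ?enorm_ge0 ?mulr_ge0// ltW.
  - by rewrite addr_ge0.
  - by rewrite lerD// ler_piMr.
have := ler_wpM2r (ltW X0) Hth; have := ler_wpM2r (ltW X0) Hk.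
move: b1 GN; clear; lra.
Qed.

End touching.

(** * Consequences of the regularity of the solution and of the domain *)

Section regularity.
Context {R : realType} {n : nat}.
Implicit Types (x y w z q : 'rV[R]_n) (u v : 'rV[R]_n -> R) (Omega : set 'rV[R]_n).
Local Notation mu := (@lebesgue_rV R n).

Lemma derive_dotp_grad u w z : differentiable u w -> 'D_z u w = dotp (grad u w) z.
Proof.
move=> du; rewrite deriveE// {1}(row_sum_delta z) linear_sum.
by apply: eq_bigr => i _; rewrite linearZ /= mxE deriveE// mulrC.
Qed.

Lemma enorm_le_mx_norm x : enorm x <= n%:R * `|x|.
Proof.
apply: le_trans (enorm_le_sum _) _.
apply: (@le_trans _ _ (\sum_(i < n) `|x|)).
  apply: ler_sum => i _; rewrite /Num.norm/= mx_normrE.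
  exact: (@le_bigmax _ _ _ _ (fun ij : 'I_1 * 'I_n => `|x ij.1 ij.2|) (ord0, i)).
by rewrite sumr_const card_ord -[leLHS]mulr_natl.
Qed.

Lemma mvt_segment u y z : (forall t : R, 0 <= t <= 1 -> differentiable u (y + t *: z)) ->
  exists2 c : R, 0 < c < 1 & u (y + z) - u y = dotp (grad u (y + c *: z)) z.
Proof.
move=> du; pose g (t : R) := u (y + t *: z).
have quot (t : R) : (fun h : R => h^-1 *: ((g \o shift t) (h *: (1 : R)) - g t)) =
    (fun h : R => h^-1 *: ((u \o shift (y + t *: z)) (h *: z) - u (y + t *: z))).
  apply/funext => h; rewrite /g /= /shift /=; congr (_ *: (u _ - _)).
  by rewrite scalerDl [h *: 1]mulr1 addrCA.
have dg (t : R) : 0 <= t <= 1 -> is_derive t (1 : R) g (dotp (grad u (y + t *: z)) z).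
  move=> t01; apply: DeriveDef.
    by rewrite /derivable quot; exact: diff_derivable (du t t01).
  by rewrite /derive quot -derive_dotp_grad//; exact: du.
have [||c cin E] := @MVT R g (fun t => dotp (grad u (y + t *: z)) z) 0 1 ltr01.
- by move=> t; rewrite in_itv/= => /andP[t0 t1]; apply: dg; rewrite !ltW.
- apply: derivable_within_continuous => t; rewrite in_itv/= => t01.
  by have [] := dg t t01.
move: E; rewrite /g scale1r scale0r addr0 subr0 mulr1 => E.
by exists c => //; move: cin; rewrite in_itv.
Qed.

Lemma C11loc_taylor Omega u x : open Omega -> C11loc Omega u -> Omega x ->
  exists d Q K : R, [/\ 0 < d, 0 <= Q, 0 <= K & forall y, enorm (y - x) < d ->
    enorm (grad u y) <= Q /\ forall z, enorm z < d ->
      `|u (y + z) - u y - dotp (grad u y) z| <= K * enorm z ^+ 2].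
Proof.
move=> oO c11 Ox; have [_ _ [V nV [M [Mreal HM]]]] := c11 x Ox.
have /nbhs_eballP[d0 d00 dV] : nbhs x (V `&` Omega).
  by apply: filterI => //; exact: open_nbhs_nbhs.
pose k := Num.max (M + 1) 0.
have k0 : 0 <= k by rewrite le_max lexx orbT.
have kM : M < k by rewrite lt_max ltrDl ltr01.
have lip y1 y2 : V y1 -> V y2 -> enorm (grad u y1 - grad u y2) <= n%:R * k * enorm (y1 - y2).
  move=> V1 V2; apply: le_trans (enorm_le_mx_norm _) _; rewrite -mulrA ler_wpM2l//.
  have := HM k kM (y1, y2) (conj V1 V2) => /= h; apply: le_trans h _.
  by rewrite ler_wpM2l// mx_norm_le_enorm.
pose K := n%:R * k; have K0 : 0 <= K by rewrite mulr_ge0.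
pose d := d0 / 2; have d0' : 0 < d by rewrite divr_gt0.
have Vx : V x by have [] := dV x; rewrite /eball/= ?subrr ?enorm0.
exists d, (enorm (grad u x) + K * d), K; split => //.
  by rewrite addr_ge0 ?enorm_ge0 ?mulr_ge0// ltW.
move=> y yx; have yd : enorm (y - x) < d0 by rewrite (lt_trans yx)// /d ltr_pdivrMr// ltr_pMr// ltr1n.
have [Vy Oy] := dV y yd; split.
  have := enormD (grad u y - grad u x) (grad u x); rewrite subrK.
  have := lip y x Vy Vx; have := ler_wpM2l K0 (ltW yx); rewrite -/K; lra.
move=> z zd.
have inV t : 0 <= t <= 1 -> V (y + t *: z) /\ Omega (y + t *: z).
  move=> /andP[t0 t1]; have [] // : (V `&` Omega) (y + t *: z).
  apply: dV; rewrite /eball /= addrAC; apply: le_lt_trans (enormD _ _) _.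
  rewrite enormZ ger0_norm//; have : t * enorm z <= enorm z by rewrite ler_piMl ?enorm_ge0.
  by move: yx zd; rewrite /d; lra.
have [t t01|c /andP[c0 c1] ->] := @mvt_segment u y z.
  by have [_ /c11[]] := inV t t01.
rewrite -dotpNl -dotpDl; apply: le_trans (normr_dotp_le _ _) _.
rewrite expr2 mulrA ler_wpM2r ?enorm_ge0//.
have [Vc _] := inV c (introT andP (conj (ltW c0) (ltW c1))).
apply: le_trans (lip _ _ Vc Vy) _; rewrite -/K ler_wpM2l//.
rewrite addrAC subrr add0r enormZ (ger0_norm (ltW c0)).
by rewrite ler_piMl ?enorm_ge0// ltW.
Qed.

Lemma C11loc_below_paraboloid Omega u x : open Omega -> C11loc Omega u -> Omega x ->
  locally_below_paraboloid u x.
Proof.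
move=> oO c11 Ox; have [d [Q [K [d0 Q0 K0 H]]]] := C11loc_taylor oO c11 Ox.
exists d, Q, K; split => // y /H[gQ T]; exists (grad u y) => // z /T.
by rewrite ler_norml => /andP[_]; lra.
Qed.

Lemma C11loc_below_paraboloidN Omega u x : open Omega -> C11loc Omega u -> Omega x ->
  locally_below_paraboloid (fun y => - u y) x.
Proof.
move=> oO c11 Ox; have [d [Q [K [d0 Q0 K0 H]]]] := C11loc_taylor oO c11 Ox.
exists d, Q, K; split => // y /H[gQ T]; exists (- grad u y); first by rewrite enormN.
by move=> z /T; rewrite ler_norml dotpNl => /andP[+ _]; lra.
Qed.

Lemma C11loc_continuous Omega u x : C11loc Omega u -> Omega x -> {for x, continuous u}.
Proof. by move=> c11 /c11[du _ _]; exact: differentiable_continuous. Qed.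

(** Positive inside, null outside: lower semicontinuous, whatever happens on the
    boundary. *)
Lemma extension_by0_measurable Omega u : open Omega -> C11loc Omega u ->
  (forall x, Omega x -> 0 < u x) -> (forall x, ~ Omega x -> u x = 0) ->
  measurable_fun [set: 'rV[R]_n] u.
Proof.
move=> oO c11 upos u0; apply: lsc_measurable_rV => c.
have [c0|c0] := ltP c 0.
  rewrite (_ : mkset _ = setT); first exact: openT.
  apply/seteqP; split => x //= _; have [/upos|/u0 ->//] := pselect (Omega x).
  exact: lt_trans.
rewrite openE => x /= cux.
have Ox : Omega x.
  by apply: contrapT => /u0 ux0; move: cux; rewrite ux0 ltNge c0.
have nux : nbhs (u x) [set t | c < t] by apply: open_nbhs_nbhs; split => //; exact: open_gt.
exact: (C11loc_continuous c11 Ox) _ nux.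
Qed.

Lemma nearest_point Omega x : open Omega -> ~` Omega !=set0 ->
  exists2 y, ~ Omega y & forall w, ~ Omega w -> enorm (x - y) <= enorm (x - w).
Proof.
move=> oO [y0 Oy0].
pose A := ~` Omega `&` [set y | enorm (y - x) <= enorm (y0 - x)].
have cA : compact A.
  by rewrite /A setIC; apply: compact_closedI; [exact: compact_cball|exact: open_closedC].
have A0 : A !=set0 by exists y0; split => //=.
have [] := @EVT_min_rV R n (fun y => enorm (y - x)) A A0 cA.
  by apply: continuous_subspaceT; exact: continuous_enormB.
move=> y; rewrite inE => -[Oy yx] ymin; exists y => // w Ow.
rewrite !(enormB x); have [h|/ltW h] := leP (enorm (w - x)) (enorm (y0 - x)).
  by apply: ymin; rewrite inE.
exact: le_trans h.
Qed.

(** The open segment from [x] to [y] is closer to [x] than [y], hence inside the domain. *)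
Lemma nearest_point_boundary Omega x y : open Omega -> Omega x -> ~ Omega y ->
  (forall w, ~ Omega w -> enorm (x - y) <= enorm (x - w)) -> boundary Omega y.
Proof.
move=> oO Ox Oy ymin; split; last by move=> /interior_subset.
move=> B /nbhs_eballP[e e0 eB].
have xy0 : 0 < enorm (x - y).
  by apply: enorm_gt0; apply/eqP => /subr0_eq xy; apply: Oy; rewrite -xy.
pose t := Num.min 1 (e / (2 * enorm (x - y))).
have t0 : 0 < t by rewrite lt_min ltr01 divr_gt0 ?mulr_gt0.
have t1 : t <= 1 by rewrite ge_min lexx.
pose w := y + t *: (x - y); exists w; split.
  apply: contrapT => /ymin.
  have -> : x - w = (1 - t) *: (x - y) by rewrite /w scalerBl scale1r opprD addrA.
  by rewrite enormZ ger0_norm ?subr_ge0//; nra.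
apply: eB; rewrite /eball /= /w addrAC subrr add0r enormZ (ger0_norm (ltW t0)).
have : t <= e / (2 * enorm (x - y)) by rewrite ge_min lexx orbT.
rewrite ler_pdivlMr ?mulr_gt0//; lra.
Qed.

Lemma boundary_eball c (r : R) z : boundary (eball c r) z -> enorm (z - c) = r.
Proof.
move=> [cz iz]; apply: le_anti; apply/andP; split.
  rewrite leNgt; apply/negP => rz.
  have := cz (eball z (enorm (z - c) - r)) => /(_ _)[].
    by apply: nbhs_eball; rewrite subr_gt0.
  move=> w [] ; rewrite /eball /= => wc wz.
  have := enorm_distD w z c; rewrite (enormB z w); lra.
rewrite leNgt; apply/negP => zr; apply: iz.
by apply: open_nbhs_nbhs; split => //; exact: open_eball.
Qed.

End regularity.

(** * Doubling of the variables *)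

Section doubling.
Context {R : realType} {n : nat}.
Implicit Types (x y w z q : 'rV[R]_n) (u v : 'rV[R]_n -> R) (Omega : set 'rV[R]_n).
Local Notation mu := (@lebesgue_rV R n).

(** The doubled function: [L] times the modulus of the distance keeps the two points
    together, and the terms in [H] keep them near [x0] and [y0]. *)
Definition doubled u (L nu kap H : R) x0 y0 x y : R :=
  u x - u y - L * modulus nu kap (enorm (x - y)) - H * enorm (x - x0) ^+ 2
  - H * enorm (y - y0) ^+ 2.

Lemma powR2_le (nu : R) : 0 < nu <= 1 -> 2 `^ nu <= 1 + nu.
Proof.
move=> nu01; have := bernoulli_powR_concave nu01 (ler0n R 2).
by have -> : 1 + nu * (2 - 1) = 1 + nu :> R by ring.
Qed.

Lemma modulus_double (nu kap t t' : R) : 0 < nu <= 1 -> 0 < kap -> 0 <= t ->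
  0 <= t' -> t <= 2 * t' -> modulus nu kap t <= (1 + nu) * modulus nu kap t'.
Proof.
move=> nu01 kap0 t0 t'0 tt'.
apply: le_trans (ler_modulus nu01 kap0 t0 tt') _.
apply: le_trans (modulus_scale nu01 kap0 _ t'0) _; first by lra.
by rewrite ler_wpM2r ?powR2_le// ltW// modulus_gt0.
Qed.

(** The triangle inequality and the homogeneity of the modulus bound [v w - c] by
    [(1 + |w - x| / rho) `^ nu * A], and a small power grows little. *)
Lemma touching_far_bound v (L nu kap rho c eta sg : R) x y w :
  0 < nu <= 1 -> nu <= sg -> 0 < kap -> 0 < L -> rho = enorm (x - y) -> 0 < rho ->
  0 <= eta ->
  (forall w', v w' - c <= L * modulus nu kap (enorm (w' - y))) ->
  (1 - eta) * (L * modulus nu kap rho) <= v x - c ->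
  - (L * modulus nu kap rho * ((nu / sg + eta) * (1 + enorm (w - x) / rho) `^ sg))
  <= v x - v w.
Proof.
move=> nu01 nusg kap0 L0 rhoE rho0 eta0 vc vxc.
have t0 : 0 <= enorm (w - x) / rho by rewrite divr_ge0 ?enorm_ge0 ?ltW.
have A0 : 0 < L * modulus nu kap rho by rewrite mulr_gt0// modulus_gt0// ltW.
have nu0 : 0 < nu by case/andP: nu01.
have g1 : modulus nu kap (enorm (w - y)) <=
    (1 + enorm (w - x) / rho) `^ nu * modulus nu kap rho.
  apply: le_trans (modulus_scale nu01 kap0 _ (ltW rho0)); last by lra.
  apply: ler_modulus => //; first exact: enorm_ge0.
  rewrite mulrDl mul1r divfK ?gt_eqF//.
  by have := enorm_distD x w y; rewrite -rhoE; clear; lra.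
have g2 := powR_growth nu0 nusg t0.
have g3 : 1 <= (1 + enorm (w - x) / rho) `^ sg.
  have sg0 : 0 <= sg by lra.
  have := @ge0_ler_powR R sg sg0 1 (1 + enorm (w - x) / rho).
  by rewrite powR1 !nnegrE ler01 lerDl t0 addr_ge0//; apply.
have h1 := vc w.
have h2 := ler_wpM2l (ltW L0) g1.
have h3 := ler_wpM2l (ltW A0) g2.
have h4 := ler_wpM2l (mulr_ge0 eta0 (ltW A0)) g3.
move: h1 h2 h3 h4 vxc; clear; lra.
Qed.

(** Twice a concavity: that of the modulus as a function of the distance, then that of the
    square root inside the norm.  The penalisation is already a quadratic function.  The
    constant 300 covers the coefficient of the penalisation, at most 256, and that of the
    modulus, at most [2^-1]. *)
Lemma touching_near_bound v (L nu kap H rho r eta : R) x y x0 :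
  0 < nu <= 1 -> 0 < kap -> 0 < L -> rho = enorm (x - y) -> 0 < rho ->
  0 <= eta <= 1 -> rho <= 2 * r -> r <= 2 * rho -> enorm (x - x0) <= r / 4 ->
  H = 32 * eta * (L * modulus nu kap r) / r ^+ 2 ->
  (forall w, v w - L * modulus nu kap (enorm (w - y)) - H * enorm (w - x0) ^+ 2 <=
     v x - L * modulus nu kap (enorm (x - y)) - H * enorm (x - x0) ^+ 2) ->
  exists2 q, enorm q <= 300 * (L * modulus nu kap rho) / rho &
  forall w, - dotp q (w - x) - 300 * (L * modulus nu kap rho) / rho ^+ 2 *
    enorm (w - x) ^+ 2 <= v x - v w.
Proof.
move=> nu01 kap0 L0 rhoE rho0 /andP[eta0 eta1] rho2r r2rho xx0 HE vmax.
set A := L * modulus nu kap rho.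
have A0 : 0 < A by rewrite mulr_gt0// modulus_gt0// ltW.
have r0 : 0 < r by lra.
have nu0 : 0 < nu by case/andP: nu01.
have nu1 : nu <= 1 by case/andP: nu01.
have rk0 : 0 < rho + kap by lra.
pose b := A * nu / ((rho + kap) * rho).
have b0 : 0 <= b by apply: divr_ge0; apply: mulr_ge0; exact: ltW.
have bA : b <= A / rho ^+ 2.
  have -> : A / rho ^+ 2 = A / (rho * rho) by rewrite expr2.
  rewrite /b -mulrA ler_wpM2l ?(ltW A0)// ler_pdivrMr ?mulr_gt0//.
  have -> : (rho * rho)^-1 * ((rho + kap) * rho) = (rho + kap) / rho.
    by field; rewrite gt_eqF.
  by rewrite ler_pdivlMr//; move: nu1 nu0 rho0 kap0; clear; nra.
have H0 : 0 <= H.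
  by rewrite HE divr_ge0 ?mulr_ge0 ?exprn_ge0 ?(ltW L0) ?(ltW r0)// ltW// modulus_gt0// ltW.
have HrA : H * r ^+ 2 <= 64 * A.
  rewrite HE divfK ?gt_eqF ?exprn_gt0//.
  have := ler_wpM2l (ltW L0) (modulus_double nu01 kap0 (ltW r0) (ltW rho0) r2rho).
  rewrite mulrCA -/A => h.
  have m0 : 0 <= L * modulus nu kap r by rewrite mulr_ge0 ?(ltW L0)// ltW// modulus_gt0// ltW.
  have h' : L * modulus nu kap r <= 2 * A.
    by apply: le_trans h _; rewrite ler_wpM2r ?(ltW A0)//; move: nu1; clear; lra.
  have : eta * (L * modulus nu kap r) <= L * modulus nu kap r by rewrite ler_piMl.
  by move: h'; clear; lra.
have HA : H * rho ^+ 2 <= 256 * A.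
  have : H * rho ^+ 2 <= H * (4 * r ^+ 2).
    rewrite ler_wpM2l// (_ : 4 * r ^+ 2 = (2 * r) ^+ 2); last by ring.
    by rewrite lerXn2r ?nnegrE ?(ltW rho0)// mulr_ge0// ltW.
  by move: HrA; clear; lra.
pose q := b *: (x - y) + (2 * H) *: (x - x0).
exists q.
  apply: le_trans (enormD _ _) _; rewrite !enormZ -rhoE ger0_norm// ger0_norm ?mulr_ge0//.
  have hb : b * rho <= A / rho.
    by rewrite ler_pdivlMr// -mulrA -expr2 -ler_pdivlMr ?exprn_gt0.
  have hH : 2 * H * enorm (x - x0) <= 64 * (A / rho).
    apply: (@le_trans _ _ (2 * H * (r / 4))); first by rewrite ler_wpM2l// mulr_ge0.
    have -> : 64 * (A / rho) = 64 * A / rho by rewrite mulrA.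
    rewrite ler_pdivlMr//.
    have : H * r * rho <= H * r * (2 * r) by rewrite ler_wpM2l// mulr_ge0// ltW.
    move: HrA; rewrite expr2; clear; lra.
  have -> : 300 * A / rho = 300 * (A / rho) by rewrite mulrA.
  have : 0 <= A / rho by rewrite divr_ge0// ltW.
  by move: hb hH; clear; lra.
move=> w; pose z := w - x.
have wy : w - y = (x - y) + z by rewrite /z [RHS]addrC addrA subrK.
have wx0 : w - x0 = (x - x0) + z by rewrite /z [RHS]addrC addrA subrK.
have xy0 : 0 < enorm (x - y) by rewrite -rhoE.
have g1 := modulus_tangent nu01 kap0 (ltW rho0) (enorm_ge0 (w - y)).
have g2 := enormD_le_quad z xy0.
have := vmax w; rewrite -rhoE wx0 sqr_enormD -/A.
have g3 : L * modulus nu kap (enorm (w - y)) <= A + b * (dotp (x - y) z + enorm z ^+ 2 / 2).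
  apply: le_trans (ler_wpM2l (ltW L0) g1) _.
  rewrite [leLHS]mulrA -/A [leLHS]mulrDr mulr1 lerD2l.
  have -> : b * (dotp (x - y) z + enorm z ^+ 2 / 2) =
    A * (nu * (((2 * dotp (x - y) z + enorm z ^+ 2) / (2 * rho)) / (rho + kap))).
    by rewrite /b; field; rewrite !gt_eqF.
  rewrite ler_wpM2l ?(ltW A0)// ler_wpM2l ?(ltW nu0)// ler_wpM2r ?invr_ge0 ?(ltW rk0)//.
  by move: g2; rewrite -wy -rhoE; clear; lra.
move=> g4; rewrite -/z /q (dotpDl (b *: _)) !dotpZl.
have g5 : b * (enorm z ^+ 2 / 2) + H * enorm z ^+ 2 <= 300 * A / rho ^+ 2 * enorm z ^+ 2.
  have zz := sqr_ge0 (enorm z).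
  have : H <= 256 * A / rho ^+ 2 by rewrite ler_pdivlMr ?exprn_gt0.
  have P0 : 0 <= A / rho ^+ 2 by rewrite divr_ge0 ?exprn_ge0 ?(ltW A0) ?(ltW rho0).
  rewrite -![_ * A / _]mulrA; nra.
move: g3 g4 g5; clear; lra.
Qed.

End doubling.

Section maximum.
Context {R : realType} {n : nat}.
Implicit Types (x y w z q : 'rV[R]_n) (u v : 'rV[R]_n -> R) (Omega : set 'rV[R]_n).
Local Notation mu := (@lebesgue_rV R n).

Lemma continuous_modulus (nu kap t : R) : 0 < kap -> 0 <= t ->
  {for t, continuous (modulus nu kap)}.
Proof.
move=> kap0 t0.
have tk : 0 < t + kap by lra.
have c2 : {for t + kap, continuous (fun a : R => a `^ nu)}.
  apply: differentiable_continuous; apply/derivable1_diffP.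
  by apply: derivable_powR; rewrite in_itv/= andbT.
have c1 : {for t, continuous (fun a : R => a + kap)}.
  by apply: continuousD => //; exact: cst_continuous.
exact: continuous_comp c1 c2.
Qed.

Lemma continuous_doubled u (L nu kap H : R) x0 y0 x y : 0 < kap ->
  {for x, continuous u} -> {for y, continuous u} ->
  {for (x, y), continuous (fun P => doubled u L nu kap H x0 y0 P.1 P.2)}.
Proof.
move=> kap0 cx cy.
have c1 : {for (x, y), continuous (fun P : 'rV[R]_n * 'rV[R]_n => P.1)} by exact: cvg_fst.
have c2 : {for (x, y), continuous (fun P : 'rV[R]_n * 'rV[R]_n => P.2)} by exact: cvg_snd.
have cm : {for (x, y), continuous (fun P : 'rV[R]_n * 'rV[R]_n => enorm (P.1 - P.2))}.
  have cB : {for (x, y), continuous (fun P : 'rV[R]_n * 'rV[R]_n => P.1 - P.2)}.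
    exact: continuousB.
  have ce := @continuous_enormB R n 0 (x - y).
  have -> : (fun P : 'rV[R]_n * 'rV[R]_n => enorm (P.1 - P.2)) =
    (fun w => enorm (w - 0)) \o (fun P => P.1 - P.2) by apply/funext => P /=; rewrite subr0.
  exact: continuous_comp cB ce.
have csq x' (f : 'rV[R]_n * 'rV[R]_n -> 'rV[R]_n) : {for (x, y), continuous f} ->
    {for (x, y), continuous (fun P => H * enorm (f P - x') ^+ 2)}.
  move=> cf; apply: continuousM; first exact: cst_continuous.
  have ce : {for (x, y), continuous (fun P => enorm (f P - x'))}.
    exact: (continuous_comp cf (@continuous_enormB R n x' (f (x, y)))).
  by rewrite (_ : (fun P => _) = (fun P => enorm (f P - x')) \* (fun P => enorm (f P - x')));
    [exact: continuousM|apply/funext => P; rewrite expr2].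
have cL : {for (x, y), continuous (fun P : 'rV[R]_n * 'rV[R]_n =>
    L * modulus nu kap (enorm (P.1 - P.2)))}.
  have cmod : {for enorm ((x, y).1 - (x, y).2), continuous (modulus nu kap)}.
    by apply: continuous_modulus => //; exact: enorm_ge0.
  by apply: continuousM; [exact: cst_continuous|exact: continuous_comp cm cmod].
have cu1 : {for (x, y), continuous (fun P : 'rV[R]_n * 'rV[R]_n => u P.1)}.
  exact: (continuous_comp c1 cx).
have cu2 : {for (x, y), continuous (fun P : 'rV[R]_n * 'rV[R]_n => u P.2)}.
  exact: (continuous_comp c2 cy).
apply: continuousB; last exact: csq c2.
apply: continuousB; last exact: csq c1.
apply: continuousB; last exact: cL.
exact: (continuousB cu1 cu2).
Qed.

Lemma doubled_max_pair u (L nu kap H r : R) x0 y0 : 0 < kap -> 0 <= r ->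
  (forall x, enorm (x - x0) <= r -> {for x, continuous u}) ->
  (forall y, enorm (y - y0) <= r -> {for y, continuous u}) ->
  exists x1 y1, [/\ enorm (x1 - x0) <= r, enorm (y1 - y0) <= r &
    forall x y, enorm (x - x0) <= r -> enorm (y - y0) <= r ->
    doubled u L nu kap H x0 y0 x y <= doubled u L nu kap H x0 y0 x1 y1].
Proof.
move=> kap0 r0 cx cy.
pose A := [set x | enorm (x - x0) <= r] `*` [set y | enorm (y - y0) <= r].
have cA : compact A by apply: compact_setX; exact: compact_cball.
have A0 : A !=set0 by exists (x0, y0); split; rewrite /= subrr enorm0.
have [] := @compact_EVT_max _ R (fun P => doubled u L nu kap H x0 y0 P.1 P.2) A A0 cA.
  apply: continuous_in_subspaceT => -[x y]; rewrite inE => -[/= xA yA].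
  by apply: continuous_doubled => //; [exact: cx|exact: cy].
move=> [x1 y1]; rewrite inE => -[/= x1A y1A] mx; exists x1, y1; split => // x y xA yA.
by apply: (mx (x, y)); rewrite inE.
Qed.

(** Here the second variable stays at [y0], where [u] may be discontinuous. *)
Lemma doubled_max_single u (L nu kap H r : R) x0 y0 : 0 < kap -> 0 <= r ->
  (forall x, enorm (x - x0) <= r -> {for x, continuous u}) ->
  exists2 x1, enorm (x1 - x0) <= r &
    forall x, enorm (x - x0) <= r ->
    doubled u L nu kap H x0 y0 x y0 <= doubled u L nu kap H x0 y0 x1 y0.
Proof.
move=> kap0 r0 cx.
pose A := [set x | enorm (x - x0) <= r].
have cA : compact A by exact: compact_cball.
have A0 : A !=set0 by exists x0; rewrite /A /= subrr enorm0.
have [] := @EVT_max_rV R n (fun x => doubled u L nu kap H x0 y0 x y0) A A0 cA.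
  apply: continuous_in_subspaceT => x; rewrite inE => xA.
  have csq x' : {for x, continuous (fun w : 'rV[R]_n => enorm (w - x'))}.
    exact: continuous_enormB.
  have cL : {for x, continuous (fun w => L * modulus nu kap (enorm (w - y0)))}.
    have cmod : {for enorm (x - y0), continuous (modulus nu kap)}.
      by apply: continuous_modulus => //; exact: enorm_ge0.
    by apply: continuousM; [exact: cst_continuous|exact: continuous_comp (csq y0) cmod].
  have cH : {for x, continuous (fun w => H * enorm (w - x0) ^+ 2)}.
    apply: continuousM; first exact: cst_continuous.
    have -> : (fun w : 'rV[R]_n => enorm (w - x0) ^+ 2) =
        (fun w => enorm (w - x0)) \* (fun w => enorm (w - x0)).
      by apply/funext => w; rewrite expr2.
    exact: continuousM.
  have c k : {for x, continuous (fun=> k : R)} by exact: cst_continuous.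
  exact: (continuousB (continuousB (continuousB (continuousB (cx x xA) (c (u y0))) cL) cH)
    (c (H * enorm (y0 - y0) ^+ 2))).
move=> x1; rewrite inE => x1A mx; exists x1 => // x xA.
by apply: mx; rewrite inE.
Qed.

(** The penalisation is calibrated so that leaving the balls of radius [r / 4] costs
    twice what [(x0, y0)] lacks from being optimal; hence [32 = 2 * 4 ^ 2]. *)
Lemma doubled_max_global u (L nu kap eta r H : R) x0 y0 x1 y1 (Y : set 'rV[R]_n) :
  0 < kap -> 0 < L -> 0 < eta -> r = enorm (x0 - y0) -> 0 < r ->
  H = 32 * eta * (L * modulus nu kap r) / r ^+ 2 ->
  (forall x y, u x - u y <= L * modulus nu kap (enorm (x - y))) ->
  (1 - eta) * (L * modulus nu kap r) <= u x0 - u y0 ->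
  Y y0 ->
  (forall x y, enorm (x - x0) <= r / 4 -> Y y ->
    doubled u L nu kap H x0 y0 x y <= doubled u L nu kap H x0 y0 x1 y1) -> Y y1 ->
  enorm (x1 - x0) <= r / 4 ->
  [/\ L * modulus nu kap (enorm (x1 - y1)) - eta * (L * modulus nu kap r) <= u x1 - u y1,
      forall w, doubled u L nu kap H x0 y0 w y1 <= doubled u L nu kap H x0 y0 x1 y1 &
      (forall w, enorm (w - y0) <= r / 4 -> Y w) ->
      forall w, doubled u L nu kap H x0 y0 x1 w <= doubled u L nu kap H x0 y0 x1 y1].
Proof.
move=> kap0 L0 eta0 rE r0 HE hL h0 Yy0 mx Yy1 x1r.
set A := L * modulus nu kap r in HE h0 *.
have A0 : 0 < A by rewrite mulr_gt0// modulus_gt0// ltW.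
have H0 : 0 <= H.
  rewrite HE; apply: divr_ge0; last by rewrite exprn_ge0// ltW.
  by apply: mulr_ge0; [apply: mulr_ge0 => //|]; exact: ltW.
have out w w0 : r / 4 <= enorm (w - w0) -> 2 * eta * A <= H * enorm (w - w0) ^+ 2.
  move=> rw; have -> : 2 * eta * A = H * (r / 4) ^+ 2.
    by rewrite HE; field; rewrite gt_eqF.
  by rewrite ler_wpM2l// lerXn2r ?nnegrE ?enorm_ge0// divr_ge0// ltW.
have base : - (eta * A) <= doubled u L nu kap H x0 y0 x1 y1.
  apply: le_trans (mx x0 y0 _ Yy0); last by rewrite subrr enorm0 divr_ge0// ltW.
  rewrite /doubled !subrr enorm0 expr0n /= !mulr0 -rE -/A; move: h0; clear; lra.
have sq0 w w0 : 0 <= H * enorm (w - w0) ^+ 2 by rewrite mulr_ge0// exprn_ge0// enorm_ge0.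
have eA : 0 < eta * A by rewrite mulr_gt0.
have outside x y w w0 : r / 4 <= enorm (w - w0) ->
    H * enorm (w - w0) ^+ 2 <= H * enorm (x - x0) ^+ 2 + H * enorm (y - y0) ^+ 2 ->
    doubled u L nu kap H x0 y0 x y <= doubled u L nu kap H x0 y0 x1 y1.
  move=> /out h h'; apply: le_trans base; rewrite /doubled.
  have := hL x y; move: h h' eA; clear; lra.
split.
- by move: base (sq0 x1 x0) (sq0 y1 y0); rewrite /doubled; clear; lra.
- move=> w; have [wr|/ltW wr] := leP (enorm (w - x0)) (r / 4); first exact: mx.
  by apply: (outside _ _ _ _ wr); rewrite lerDl.
- move=> YB w; have [wr|/ltW wr] := leP (enorm (w - y0)) (r / 4).
    by apply: mx => //; exact: YB.
  by apply: (outside _ _ _ _ wr); rewrite lerDr.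
Qed.

End maximum.

(** * The two cases of the doubling argument *)

Section doubling_estimates.
Context {R : realType} {n : nat}.
Implicit Types (x y w z q : 'rV[R]_n) (u v : 'rV[R]_n -> R) (Omega : set 'rV[R]_n).
Local Notation mu := (@lebesgue_rV R n).

Definition admissible_point (s p : R) u (N : R) x :=
  [/\ {for x, continuous u},
      locally_below_paraboloid u x, locally_below_paraboloid (fun w => - u w) x,
      fplap_le_near s p u N x & fplap_le_near s p (fun w => - u w) N x].

(** Half of the lower bound for the volume of a ball of radius [rho / 4], divided by
    [rho ^+ n]; the half is for the interior case, where the gain is shared by two points. *)
Definition gain_volume : R := 2^-1 * (2 * n.+1%:R)^-1 ^+ n.

(** Where [nu] is small and [rho] at most 1, the negative power of [rho] wins. *)
Lemma powR_rescale (L nu kap rho s p : R) : 2 <= p -> 0 < s -> 0 < nu <= 1 -> 0 < kap ->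
  0 <= L -> 0 < rho <= 1 -> nu * (p - 1) <= s * p ->
  L `^ (p - 1) <= (L * modulus nu kap rho) `^ (p - 1) * rho `^ (- (s * p)).
Proof.
move=> p2 s0 nu01 kap0 L0 /andP[r0 r1] nup.
have r00 := ltW r0.
have h1 : L * rho `^ nu <= L * modulus nu kap rho.
  by rewrite ler_wpM2l// modulus_ge_powR.
apply: (@le_trans _ _ ((L * rho `^ nu) `^ (p - 1) * rho `^ (- (s * p)))); last first.
  have l0 : 0 <= L * rho `^ nu by rewrite mulr_ge0 ?powR_ge0.
  have p10 : 0 <= p - 1 by lra.
  apply: ler_wpM2r; first exact: powR_ge0.
  by apply: (ge0_ler_powR p10 _ _ h1); rewrite nnegrE //; exact: le_trans h1.
rewrite powRM ?powR_ge0// -powRrM -mulrA -powRD; last by apply/implyP => _; rewrite gt_eqF.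
rewrite ler_peMr ?powR_ge0//.
have -> : nu * (p - 1) + - (s * p) = - (s * p - nu * (p - 1)) by ring.
rewrite powRN invf_ge1 ?powR_gt0//.
have := @ge0_ler_powR R (s * p - nu * (p - 1)) _ rho 1.
by rewrite powR1 !nnegrE ler01 r00 subr_ge0 => /(_ nup isT isT r1).
Qed.

(** Both variables move; the equation is used at [x1] or at [y1], whichever is far in value
    from at least half of the points near the middle. *)
Lemma interior_estimate (s p c k0 : R) u (N M L nu kap r : R) x0 y0 :
  2 <= p -> 0 < s -> 0 < c -> touching_property (n := n) s p 300 gain_volume c k0 ->
  0 < nu -> nu <= 12^-1 -> nu <= s * p / 2 / (p - 1) ->
  nu / (s * p / 2 / (p - 1)) + 4 * nu <= k0 -> nu * (p - 1) <= s * p ->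
  0 < kap -> 0 < L ->
  measurable_fun setT u -> (forall w, `|u w| <= M) ->
  (forall x y, u x - u y <= L * modulus nu kap (enorm (x - y))) ->
  r = enorm (x0 - y0) -> 0 < r <= 2^-1 ->
  (1 - 2 * nu) * (L * modulus nu kap r) <= u x0 - u y0 ->
  (forall w, enorm (w - x0) <= r / 4 -> admissible_point s p u N w) ->
  (forall w, enorm (w - y0) <= r / 4 -> admissible_point s p u N w) ->
  c * L `^ (p - 1) <= N.
Proof.
move=> p2 s0 c0 TE nu0 nu12 nusg nuk nup kap0 L0 mu_ uM hL rE /andP[r0 rhalf] h0 goodx goody.
have nu01 : 0 < nu <= 1 by rewrite nu0; move: nu12; clear; lra.
pose H := 32 * (2 * nu) * (L * modulus nu kap r) / r ^+ 2.
have r4 : 0 <= r / 4 by rewrite divr_ge0// ltW.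
have [x1 [y1 [x1r y1r mx]]] : exists x1 y1,
    [/\ enorm (x1 - x0) <= r / 4, enorm (y1 - y0) <= r / 4 &
    forall x y, enorm (x - x0) <= r / 4 -> enorm (y - y0) <= r / 4 ->
    doubled u L nu kap H x0 y0 x y <= doubled u L nu kap H x0 y0 x1 y1].
  by apply: doubled_max_pair => // [x /goodx[]|y /goody[]].
have eta0 : 0 < 2 * nu by rewrite mulr_gt0.
have Yy0 : enorm (y0 - y0) <= r / 4 by rewrite subrr enorm0.
have [base mxx mxy] := @doubled_max_global R n u L nu kap (2 * nu) r H x0 y0 x1 y1
  [set y | enorm (y - y0) <= r / 4] kap0 L0 eta0 rE r0 erefl hL h0
  Yy0 mx y1r x1r.
have {}mxy := mxy (fun w h => h).
pose rho := enorm (x1 - y1); pose A := L * modulus nu kap rho.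
have rho_lo : r / 2 <= rho.
  have h1 := enorm_distD x1 x0 y0; have h2 := enorm_distD y1 x1 y0.
  move: h1 h2 x1r y1r; rewrite (enormB x0 x1) -rE -/rho; clear; lra.
have rho_hi : rho <= 3 / 2 * r.
  have h1 := enorm_distD x0 x1 y1; have h2 := enorm_distD y0 x0 y1.
  move: h1 h2 x1r y1r; rewrite (enormB y0 y1) -rE -/rho; clear; lra.
have rho0 : 0 < rho by move: rho_lo r0; clear; lra.
have rho1 : rho <= 1 by move: rho_hi rhalf; clear; lra.
have A0 : 0 < A by rewrite mulr_gt0// modulus_gt0// ltW.
have rle : r <= 2 * rho by move: rho_lo; clear; lra.
have diff : (1 - 4 * nu) * A <= u x1 - u y1.
  apply: le_trans base; rewrite -/rho -/A.
  have := modulus_double nu01 kap0 (ltW r0) (ltW rho0) rle.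
  move=> /(ler_wpM2l (ltW L0)); rewrite mulrCA -/A => h.
  have h' : L * modulus nu kap r <= 2 * A.
    by apply: le_trans h _; rewrite ler_wpM2r ?(ltW A0)//; move: nu12; clear; lra.
  have := ler_wpM2l (ltW nu0) h'; clear; lra.
have [g1 g2 g3 g4] : [/\ locally_below_paraboloid u x1, fplap_le_near s p u N x1,
    locally_below_paraboloid (fun w => - u w) y1 &
    fplap_le_near s p (fun w => - u w) N y1].
  by have [_ ? ? ? ?] := goodx x1 x1r; have [_ ? ? ? ?] := goody y1 y1r.
pose sg := s * p / 2 / (p - 1); pose k := nu / sg + 4 * nu.
have sg0 : 0 < sg by exact: lt_le_trans nusg.
have k0' : 0 < k <= k0.
  by apply/andP; split => //; apply: addr_gt0; [exact: divr_gt0|exact: mulr_gt0].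
have nu4 : 0 <= 4 * nu by rewrite mulr_ge0// ltW.
have eta01 : 0 <= 2 * nu <= 1 by rewrite (ltW eta0); move: nu12; clear; lra.
have r2rho : rho <= 2 * r by move: rho_hi r0; clear; lra.
(* [u] is touched from above at [x1], and [- u] at [y1] *)
have farx w := @touching_far_bound R n u L nu kap rho (u y1) (4 * nu) sg x1 y1 w
  nu01 nusg kap0 L0 erefl rho0 nu4 (hL^~ y1) diff.
have rhoE' : rho = enorm (y1 - x1) by rewrite enormB.
have hLy w : - u w - (- u x1) <= L * modulus nu kap (enorm (w - x1)).
  by rewrite opprK addrC enormB; exact: hL.
have diffy : (1 - 4 * nu) * A <= - u y1 - - u x1 by rewrite opprK [leRHS]addrC.
have fary w := @touching_far_bound R n (fun w => - u w) L nu kap rho (- u x1) (4 * nu) sg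
  y1 x1 w nu01 nusg kap0 L0 rhoE' rho0 nu4 hLy diffy.
have [qx qxle nearx] : exists2 q, enorm q <= 300 * A / rho &
    forall w, - dotp q (w - x1) - 300 * A / rho ^+ 2 * enorm (w - x1) ^+ 2 <= u x1 - u w.
  apply: (touching_near_bound nu01 kap0 L0 erefl rho0 eta01 r2rho rle x1r erefl).
  by move=> w; have := mxx w; rewrite /doubled -/H; clear; lra.
have [qy qyle neary] : exists2 q, enorm q <= 300 * A / rho &
    forall w, - dotp q (w - y1) - 300 * A / rho ^+ 2 * enorm (w - y1) ^+ 2 <= - u y1 - - u w.
  apply: (touching_near_bound (v := fun w => - u w) nu01 kap0 L0 rhoE' rho0 eta01 r2rho rle
    y1r erefl).
  by move=> w; have := mxy w; rewrite /doubled -/H (enormB x1 w) (enormB x1 y1); clear; lra.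
have resc : L `^ (p - 1) <= A `^ (p - 1) * rho `^ (- (s * p)).
  exact: (powR_rescale p2 s0 nu01 kap0 (ltW L0) (introT andP (conj rho0 rho1)) nup).
apply: (@le_trans _ _ (c * (A `^ (p - 1) * rho `^ (- (s * p))))).
  by rewrite ler_wpM2l// ltW.
(* each point near the middle is far in value from one of the two ends *)
pose mid := 2^-1 *: (x1 + y1).
pose E := eball mid (rho / 4).
have midx w : E w -> rho / 4 <= enorm (w - x1) <= 4 * rho /\
                     rho / 4 <= enorm (w - y1) <= 4 * rho.
  rewrite /E /eball /= => wm.
  have hm : x1 - mid = 2^-1 *: (x1 - y1).
    by apply/rowP => i; rewrite !mxE; field.
  have hm' : y1 - mid = - (2^-1 *: (x1 - y1)).
    by apply/rowP => i; rewrite !mxE; field.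
  have e1 : enorm (x1 - mid) = rho / 2 by rewrite hm enormZ ger0_norm ?invr_ge0// mulrC.
  have e2 : enorm (y1 - mid) = rho / 2.
    by rewrite hm' enormN enormZ ger0_norm ?invr_ge0// mulrC.
  have := enorm_distD mid w x1; have := enorm_distD mid w y1.
  have := enorm_distD w x1 mid; have := enorm_distD w y1 mid.
  rewrite (enormB x1 w) (enormB y1 w) (enormB mid x1) (enormB mid y1) e1 e2.
  by move: wm rho0; clear => *; split; apply/andP; split; lra.
pose E1 := E `&` [set w | A / 3 <= u x1 - u w].
pose E2 := E `&` [set w | A / 3 <= u w - u y1].
have mE : measurable E by exact: measurable_eball.
have mge (g : 'rV[R]_n -> R) : measurable_fun setT g -> measurable [set w | A / 3 <= g w].
  move=> mg; rewrite (_ : mkset _ = setT `&` g @^-1` `[A / 3, +oo[).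
    by apply: mg => //; exact: measurable_itv.
  by rewrite setTI; apply/seteqP; split => w /=; rewrite in_itv/= andbT.
have mE1 : measurable E1.
  apply: measurableI => //; apply: mge.
  by apply: measurable_funB => //; exact: measurable_cst.
have mE2 : measurable E2.
  apply: measurableI => //; apply: mge.
  by apply: measurable_funB => //; exact: measurable_cst.
(* [u x1 - u y1] is at least [2 / 3 * A], because [nu <= 12^-1] *)
have EE : E `<=` E1 `|` E2.
  move=> w Ew; have [h|h] := leP (A / 3) (u x1 - u w); [by left|right; split => //=].
  have : 4 * nu * A <= 3^-1 * A by rewrite ler_wpM2r ?(ltW A0)//; move: nu12; clear; lra.
  by move: h diff; clear; lra.
have volE : ((2 * (gain_volume * rho ^+ n))%:E <= mu E)%E.
  have := @lebesgue_eball_ge R n mid (rho / 4); rewrite divr_gt0// => /(_ isT).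
  apply: le_trans; rewrite lee_fin /gain_volume.
  have -> : 2 * (rho / 4 / n.+1%:R) = (2 * n.+1%:R)^-1 * rho.
    have : n.+1%:R != 0 :> R by rewrite pnatr_eq0.
    by move: (n.+1%:R : R) => a a0; field.
  by rewrite exprMn !mulrA mulfV// mul1r.
have [v1|v2] : ((gain_volume * rho ^+ n)%:E <= mu E1)%E \/
               ((gain_volume * rho ^+ n)%:E <= mu E2)%E.
  apply/orP; rewrite -implyNb; apply/implyP; rewrite -ltNge => v1.
  rewrite leNgt; apply/negP => v2.
  have : (mu E <= mu E1 + mu E2)%E.
    apply: le_trans (_ : mu (E1 `|` E2) <= _)%E; last exact: measureU2.
    by apply: le_measure => //; rewrite inE//; exact: measurableU.
  apply/negP; rewrite -ltNge; apply: lt_le_trans volE.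
  apply: lt_le_trans (lteD v1 v2) _.
  by rewrite -EFinD lee_fin mulr_natl mulr2n.
- apply: (TE u x1 qx rho A N M k E1) => //.
  + by move=> w [/midx[]].
  + by move=> w [].
- apply: (TE (fun w => - u w) y1 qy rho A N M k E2) => //.
  + exact: measurableT_comp mu_.
  + by move=> w; rewrite normrN.
  + by move=> w [/midx[]].
  + by move=> w [_ /=]; rewrite opprK addrC.
Qed.

(** Only [x] moves, and the equation is used at the maximum point; the function vanishes on a
    ball of radius [r / 2] that touches the boundary at [y0]. *)
Lemma boundary_estimate (s p c k0 : R) Omega u (N M L nu kap r r0 : R) x0 y0 b :
  2 <= p -> 0 < s -> 0 < c -> touching_property (n := n) s p 300 gain_volume c k0 ->
  0 < nu -> nu <= 12^-1 -> nu <= s * p / 2 / (p - 1) ->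
  nu / (s * p / 2 / (p - 1)) + 4 * nu <= k0 -> nu * (p - 1) <= s * p ->
  0 < kap -> 0 < L ->
  measurable_fun setT u -> (forall w, `|u w| <= M) ->
  (forall x y, u x - u y <= L * modulus nu kap (enorm (x - y))) ->
  r = enorm (x0 - y0) -> 0 < r <= 2^-1 -> r <= r0 ->
  (1 - 2 * nu) * (L * modulus nu kap r) <= u x0 - u y0 ->
  (forall w, Omega w -> admissible_point s p u N w) -> (forall w, ~ Omega w -> u w = 0) ->
  ~ Omega y0 -> (forall w, ~ Omega w -> r <= enorm (x0 - w)) ->
  enorm (y0 - b) = r0 -> (forall w, eball b r0 w -> ~ Omega w) ->
  c * L `^ (p - 1) <= N.
Proof.
move=> p2 s0 c0 TE nu0 nu12 nusg nuk nup kap0 L0 mu_ uM hL rE /andP[rp rhalf] rr0 h0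
  good u0 Oy0 dist yb bO.
have nu01 : 0 < nu <= 1 by rewrite nu0; move: nu12; clear; lra.
pose H := 32 * (2 * nu) * (L * modulus nu kap r) / r ^+ 2.
have r4 : 0 <= r / 4 by rewrite divr_ge0// ltW.
have goodx w : enorm (w - x0) <= r / 4 -> admissible_point s p u N w.
  move=> wx; apply: good; apply: contrapT => /dist; rewrite enormB.
  by move: wx rp; clear; lra.
have [x1 x1r mx] := @doubled_max_single R n u L nu kap H (r / 4) x0 y0 kap0 r4
  (fun x xr => let: And5 h _ _ _ _ := goodx x xr in h).
have eta0 : 0 < 2 * nu by rewrite mulr_gt0.
have mx' x y : enorm (x - x0) <= r / 4 -> [set y0] y ->
    doubled u L nu kap H x0 y0 x y <= doubled u L nu kap H x0 y0 x1 y0.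
  by move=> xr ->; exact: mx.
have [base mxx _] := @doubled_max_global R n u L nu kap (2 * nu) r H x0 y0 x1 y0
  [set y0] kap0 L0 eta0 rE rp erefl hL h0 erefl mx' erefl x1r.
pose rho := enorm (x1 - y0); pose A := L * modulus nu kap rho.
have rho_lo : 3 / 4 * r <= rho.
  have := enorm_distD x1 x0 y0; move: x1r; rewrite (enormB x0 x1) -rE -/rho; clear; lra.
have rho_hi : rho <= 5 / 4 * r.
  have := enorm_distD x0 x1 y0; move: x1r; rewrite -rE -/rho; clear; lra.
have rho0 : 0 < rho by move: rho_lo rp; clear; lra.
have rho1 : rho <= 1 by move: rho_hi rhalf; clear; lra.
have A0 : 0 < A by rewrite mulr_gt0// modulus_gt0// ltW.
have rle : r <= 2 * rho by move: rho_lo rp; clear; lra.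
have diff : (1 - 4 * nu) * A <= u x1 - u y0.
  apply: le_trans base; rewrite -/rho -/A.
  have := modulus_double nu01 kap0 (ltW rp) (ltW rho0) rle.
  move=> /(ler_wpM2l (ltW L0)); rewrite mulrCA -/A => h.
  have h' : L * modulus nu kap r <= 2 * A.
    by apply: le_trans h _; rewrite ler_wpM2r ?(ltW A0)//; move: nu12; clear; lra.
  have := ler_wpM2l (ltW nu0) h'; clear; lra.
have [_ g1 _ g2 _] := goodx x1 x1r.
pose sg := s * p / 2 / (p - 1); pose k := nu / sg + 4 * nu.
have sg0 : 0 < sg by exact: lt_le_trans nusg.
have k0' : 0 < k <= k0.
  by apply/andP; split => //; apply: addr_gt0; [exact: divr_gt0|exact: mulr_gt0].
have nu4 : 0 <= 4 * nu by rewrite mulr_ge0// ltW.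
have eta01 : 0 <= 2 * nu <= 1 by rewrite (ltW eta0); move: nu12; clear; lra.
have r2rho : rho <= 2 * r by move: rho_hi rp; clear; lra.
have farx w := @touching_far_bound R n u L nu kap rho (u y0) (4 * nu) sg x1 y0 w
  nu01 nusg kap0 L0 erefl rho0 nu4 (hL^~ y0) diff.
have [qx qxle nearx] : exists2 q, enorm q <= 300 * A / rho &
    forall w, - dotp q (w - x1) - 300 * A / rho ^+ 2 * enorm (w - x1) ^+ 2 <= u x1 - u w.
  apply: (touching_near_bound nu01 kap0 L0 erefl rho0 eta01 r2rho rle x1r erefl).
  by move=> w; have := mxx w; rewrite /doubled -/H; clear; lra.
have resc : L `^ (p - 1) <= A `^ (p - 1) * rho `^ (- (s * p)).
  exact: (powR_rescale p2 s0 nu01 kap0 (ltW L0) (introT andP (conj rho0 rho1)) nup).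
apply: (@le_trans _ _ (c * (A `^ (p - 1) * rho `^ (- (s * p))))).
  by rewrite ler_wpM2l// ltW.
(* [u] vanishes on a ball of radius comparable to [rho], inside the exterior ball *)
have r00 : 0 < r0 by exact: lt_le_trans rr0.
pose t := r / 2 / r0.
have t0 : 0 <= t by rewrite /t !divr_ge0// ltW.
have t1 : t <= 1 by rewrite /t ler_pdivrMr// mul1r; move: rr0 rp; clear; lra.
pose b' := y0 + t *: (b - y0).
have by0 : enorm (b' - y0) = r / 2.
  rewrite /b' addrAC subrr add0r enormZ ger0_norm// (enormB b) yb.
  by rewrite /t divfK// gt_eqF.
have b'b : enorm (b' - b) = r0 - r / 2.
  have -> : b' - b = (1 - t) *: (y0 - b).
    by apply/rowP => i; rewrite !mxE; ring.
  rewrite enormZ yb ger0_norm ?subr_ge0// mulrBl mul1r.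
  by rewrite /t divfK// gt_eqF.
pose E := eball b' (r / 2).
have EO w : E w -> ~ Omega w.
  rewrite /E /eball /= => wb; apply: bO; rewrite /eball /=.
  by have := enorm_distD b' w b; rewrite b'b; move: wb; clear; lra.
have E_y0 w : E w -> enorm (w - y0) <= r.
  rewrite /E /eball /= => wb.
  by have := enorm_distD b' w y0; rewrite by0; move: wb; clear; lra.
apply: (TE u x1 qx rho A N M k E) => //.
- exact: measurable_eball.
- move=> w Ew; have := dist w (EO w Ew); have := E_y0 w Ew.
  have := enorm_distD x1 x0 w; have := enorm_distD y0 w x1.
  move: x1r rho_lo rho_hi rp; rewrite (enormB x0 x1) (enormB x1 w) (enormB y0 x1) -/rho.
  by clear => *; apply/andP; split; lra.
- move=> w /EO Ow; rewrite (u0 w Ow) -(u0 y0 Oy0).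
  have : 4 * nu * A <= 3^-1 * A by rewrite ler_wpM2r ?(ltW A0)//; move: nu12; clear; lra.
  by move: A0 diff; clear; lra.
- have r2 : 0 < r / 2 by rewrite divr_gt0.
  apply: le_trans (lebesgue_eball_ge b' r2); rewrite lee_fin /gain_volume.
  have n0 : 0 < n.+1%:R :> R by rewrite ltr0n.
  apply: (@le_trans _ _ ((2 * n.+1%:R)^-1 ^+ n * rho ^+ n)).
    rewrite -mulrA ler_piMl// ?mulr_ge0 ?exprn_ge0 ?invr_ge0 ?mulr_ge0 ?(ltW n0) ?(ltW rho0)//.
    by rewrite invf_le1// ler1n.
  rewrite -exprMn; apply: lerXn2r; rewrite ?nnegrE.
  + by apply: mulr_ge0; [rewrite invr_ge0 mulr_ge0// ltW|exact: ltW].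
  + by apply: mulr_ge0 => //; apply: divr_ge0; exact: ltW.
  + rewrite invfM mulrAC mulrA ler_wpM2r ?invr_ge0 ?(ltW n0)//.
    by move: rho_hi rp; clear; lra.
Qed.

End doubling_estimates.

(** * The global estimate *)

Section global_estimate.
Context {R : realType} {n : nat}.
Implicit Types (x y w z q : 'rV[R]_n) (u v : 'rV[R]_n -> R) (Omega : set 'rV[R]_n).
Local Notation mu := (@lebesgue_rV R n).

Lemma gain_volume_gt0 : 0 < @gain_volume R n.
Proof. by rewrite /gain_volume mulr_gt0 ?exprn_gt0 ?invr_gt0 ?mulr_gt0 ?ltr0n. Qed.

Lemma root_bound (p c L N : R) : 2 <= p -> 0 < c -> 0 <= L -> 0 <= N ->
  c * L `^ (p - 1) <= N -> L <= c^-1 `^ (p - 1)^-1 * N `^ (p - 1)^-1.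
Proof.
move=> p2 c0 L0 N0 h; have p10 : 0 < p - 1 by lra.
rewrite -powRM ?invr_ge0 ?(ltW c0)//.
have -> : L = (L `^ (p - 1)) `^ (p - 1)^-1.
  by rewrite -powRrM mulfV ?gt_eqF// powRr1.
have i0 : 0 <= (p - 1)^-1 by rewrite invr_ge0 ltW.
apply: (ge0_ler_powR i0); rewrite ?nnegrE ?powR_ge0//.
  by rewrite mulr_ge0 ?invr_ge0 ?(ltW c0).
by rewrite mulrC ler_pdivlMr// mulrC.
Qed.

(** The choice between the two cases, for an almost optimal pair [(x0, y0)]. *)
Lemma modulus_quotient_bound (s p c k0 nu : R) Omega u (N M U L kap R0 r0 : R) x0 y0 :
  2 <= p -> 0 < s -> 0 < c -> touching_property (n := n) s p 300 (@gain_volume R n) c k0 ->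
  0 < nu -> nu <= 12^-1 -> nu <= s * p / 2 / (p - 1) ->
  nu / (s * p / 2 / (p - 1)) + 4 * nu <= k0 ->
  0 < kap -> 0 < L -> 0 < R0 -> R0 <= 4^-1 -> 2 * R0 <= r0 ->
  open Omega ->
  (forall z, boundary Omega z -> exists b, enorm (z - b) = r0 /\
     forall w, eball b r0 w -> ~ Omega w) ->
  measurable_fun setT u -> (forall w, `|u w| <= M) ->
  (forall w, Omega w -> admissible_point s p u N w) ->
  (forall w, Omega w -> 0 < u w) -> (forall w, ~ Omega w -> u w = 0) ->
  (forall w, u w <= U) -> 0 <= N ->
  (forall x y, u x - u y <= L * modulus nu kap (enorm (x - y))) ->
  (1 - nu) * (L * modulus nu kap (enorm (x0 - y0))) <= u x0 - u y0 ->
  L <= 2 * (R0 `^ nu)^-1 * U + c^-1 `^ (p - 1)^-1 * N `^ (p - 1)^-1.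
Proof.
move=> p2 s0 c0 TE nu0 nu12 nusg nuk kap0 L0 R00 R04 R0r0 oO ext mu_ uM good upos uout uU N0
  hL h0.
have nu01 : 0 < nu <= 1 by rewrite nu0; move: nu12; clear; lra.
have p10 : 0 < p - 1 by lra.
have sp0 : 0 < s * p by rewrite mulr_gt0//; lra.
have nup : nu * (p - 1) <= s * p.
  by move: nusg; rewrite ler_pdivlMr//; move: sp0; clear; lra.
have u_ge0 w : 0 <= u w.
  by have [/upos/ltW//|/uout ->] := pselect (Omega w).
have U0 : 0 <= U by exact: le_trans (u_ge0 0) (uU 0).
pose r := enorm (x0 - y0).
have f0 : 0 < L * modulus nu kap r by rewrite mulr_gt0// modulus_gt0// enorm_ge0.
have half : 2^-1 <= 1 - nu by move: nu12; clear; lra.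
have d0 : 0 < u x0 - u y0.
  by apply: lt_le_trans h0; rewrite mulr_gt0//; move: half; clear; lra.
have Ox0 : Omega x0.
  by apply: contrapT => /uout ux0; move: d0 (u_ge0 y0); rewrite ux0; clear; lra.
have r_gt0 : 0 < r.
  by apply: enorm_gt0; apply/eqP => /subr0_eq xy; move: d0; rewrite xy subrr ltxx.
have B1 : 0 <= 2 * (R0 `^ nu)^-1 * U by rewrite !mulr_ge0 ?invr_ge0 ?powR_ge0.
have B2 : 0 <= c^-1 `^ (p - 1)^-1 * N `^ (p - 1)^-1 by rewrite mulr_ge0 ?powR_ge0.
have [rR0|R0r] := leP r R0; last first.
  have m1 : R0 `^ nu <= modulus nu kap r.
    apply: le_trans (modulus_ge_powR nu01 kap0 (ltW R00)) _.
    exact: ler_modulus nu01 kap0 (ltW R00) (ltW R0r).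
  have P0 : 0 < R0 `^ nu by exact: powR_gt0.
  suff : L <= 2 * (R0 `^ nu)^-1 * U by move: B2; clear; lra.
  rewrite mulrAC ler_pdivlMr//.
  have h1 : L * R0 `^ nu <= L * modulus nu kap r by rewrite ler_wpM2l// ltW.
  have h2 : 2^-1 * (L * modulus nu kap r) <= (1 - nu) * (L * modulus nu kap r).
    by rewrite ler_wpM2r// ltW.
  by move: h1 h2 h0 (uU x0) (u_ge0 y0); rewrite -/r; clear; lra.
suff : c * L `^ (p - 1) <= N.
  by move=> /(root_bound p2 c0 (ltW L0) N0); move: B1; clear; lra.
have [[y1 [Oy1 y1r]]|noy] := pselect (exists y1, ~ Omega y1 /\ enorm (x0 - y1) <= 2 * r).
  have [y Oy ymin] := nearest_point x0 oO (ex_intro _ y1 Oy1).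
  have ry : enorm (x0 - y) <= 2 * r by exact: le_trans (ymin _ Oy1) y1r.
  have ry0 : 0 < enorm (x0 - y).
    by apply: enorm_gt0; apply/eqP => /subr0_eq xy; apply: Oy; rewrite -xy.
  have [b [yb bO]] := ext y (nearest_point_boundary oO Ox0 Oy ymin).
  (* the passage from [nu] to [2 * nu] pays for the factor [1 + nu] of the replacement *)
  have hy : (1 - 2 * nu) * (L * modulus nu kap (enorm (x0 - y))) <= u x0 - u y.
    have := modulus_double nu01 kap0 (ltW ry0) (ltW r_gt0) ry.
    move=> /(ler_wpM2l (ltW L0)) h.
    have n2 : 0 <= 1 - 2 * nu by move: nu12; clear; lra.
    apply: le_trans (ler_wpM2l n2 h) _.
    rewrite (uout y Oy) subr0; apply: (@le_trans _ _ (u x0 - u y0)); last first.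
      by have := u_ge0 y0; clear; lra.
    apply: le_trans h0; rewrite -/r.
    have -> : (1 - 2 * nu) * (L * ((1 + nu) * modulus nu kap r)) =
      ((1 - 2 * nu) * (1 + nu)) * (L * modulus nu kap r) by ring.
    by rewrite ler_wpM2r ?(ltW f0)//; move: nu0; clear; nra.
  have r1 : 0 < enorm (x0 - y) <= 2^-1.
    by rewrite ry0; move: ry rR0 R04; clear; lra.
  have r2 : enorm (x0 - y) <= r0 by move: ry rR0 R0r0; clear; lra.
  exact: (boundary_estimate p2 s0 c0 TE nu0 nu12 nusg nuk nup kap0 L0 mu_ uM hL erefl r1 r2
    hy good uout Oy ymin yb bO).
have inO w : enorm (w - x0) <= 2 * r -> Omega w.
  by move=> wx; apply: contrapT => Ow; apply: noy; exists w; rewrite enormB.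
have h0' : (1 - 2 * nu) * (L * modulus nu kap r) <= u x0 - u y0.
  by apply: le_trans h0; rewrite ler_wpM2r ?(ltW f0)//; move: nu0; clear; lra.
have r1 : 0 < r <= 2^-1 by rewrite r_gt0; move: rR0 R04; clear; lra.
apply: (interior_estimate p2 s0 c0 TE nu0 nu12 nusg nuk nup kap0 L0 mu_ uM hL erefl r1 h0').
  by move=> w wx; apply: good; apply: inO; move: wx r_gt0; rewrite -/r; clear; lra.
move=> w wx; apply: good; apply: inO.
have := enorm_distD y0 w x0; move: wx r_gt0; rewrite (enormB y0 x0) -/r; clear; lra.
Qed.

(** The exponent is limited by [k0], which makes the far loss small, and by the requirement
    that [nu] be at most [sg = s * p / 2 / (p - 1)]. *)
Lemma holder_estimate (s p r0 : R) Omega :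
  2 <= p -> 0 < s -> s < 1 -> 0 < r0 -> open Omega ->
  (forall z, boundary Omega z -> exists b, enorm (z - b) = r0 /\
     forall w, eball b r0 w -> ~ Omega w) ->
  exists nu C : R, [/\ 0 < nu < s, 0 < C & forall u (N M U : R),
    measurable_fun setT u -> (forall w, `|u w| <= M) ->
    (forall w, Omega w -> admissible_point s p u N w) ->
    (forall w, Omega w -> 0 < u w) -> (forall w, ~ Omega w -> u w = 0) ->
    (forall w, u w <= U) -> 0 <= N ->
    forall x y, u x - u y <= C * (U + N `^ (p - 1)^-1) * enorm (x - y) `^ nu].
Proof.
move=> p2 s0 s1 r00 oO ext.
have p10 : 0 < p - 1 by lra.
have sp0 : 0 < s * p by rewrite mulr_gt0//; lra.
have [c [k0 [c0 k00 TE]]] := @touching_estimate R n s p 300 (@gain_volume R n) p2 s0 s1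
  ltac:(lra) gain_volume_gt0.
pose sg := s * p / 2 / (p - 1).
have sg0 : 0 < sg by rewrite /sg !divr_gt0.
have k1 : 0 < sg^-1 + 4 by rewrite addr_gt0 ?invr_gt0.
pose nu := Num.min (Num.min (s / 2) 12^-1) (Num.min sg (k0 / (sg^-1 + 4))).
have nu0 : 0 < nu.
  rewrite /nu !lt_min sg0 invr_gt0 ltr0n /= andbT; apply/andP.
  by split; exact: divr_gt0.
have nus : nu <= s / 2 by rewrite /nu !ge_min lexx.
have nu12 : nu <= 12^-1 by rewrite /nu !ge_min lexx !orbT.
have nusg : nu <= sg by rewrite /nu !ge_min lexx !orbT.
have nuk : nu / sg + 4 * nu <= k0.
  have : nu <= k0 / (sg^-1 + 4) by rewrite /nu !ge_min lexx !orbT.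
  by rewrite ler_pdivlMr// mulrDr (mulrC nu 4).
have nu01 : 0 < nu <= 1 by rewrite nu0; move: nu12; clear; lra.
pose R0 := Num.min 4^-1 (r0 / 2).
have R00 : 0 < R0 by rewrite /R0 lt_min invr_gt0 ltr0n divr_gt0.
have R04 : R0 <= 4^-1 by rewrite /R0 ge_min lexx.
have R0r0 : 2 * R0 <= r0.
  have : R0 <= r0 / 2 by rewrite /R0 ge_min lexx orbT.
  by clear; lra.
pose C := 4 * (R0 `^ nu)^-1 + 2 * c^-1 `^ (p - 1)^-1.
have Ca : 0 < (R0 `^ nu)^-1 by rewrite invr_gt0 powR_gt0.
have Cb : 0 < c^-1 `^ (p - 1)^-1 by apply: powR_gt0; rewrite invr_gt0.
exists nu, C; split.
- by rewrite nu0; move: nus s0; clear; lra.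
- by rewrite /C; move: Ca Cb; clear; lra.
move=> u N M U mu_ uM good upos uout uU N0 x y.
have u_ge0 w : 0 <= u w.
  by have [/upos/ltW//|/uout ->] := pselect (Omega w).
have U0 : 0 <= U by exact: le_trans (u_ge0 0) (uU 0).
have N0' := powR_ge0 N (p - 1)^-1.
have [xy|xy] := eqVneq x y.
  by rewrite xy subrr !mulr_ge0 ?addr_ge0 ?powR_ge0// /C; move: Ca Cb; clear; lra.
pose kap := enorm (x - y).
have kap0 : 0 < kap by rewrite enorm_gt0// subr_eq0.
pose Q (P : 'rV[R]_n * 'rV[R]_n) := (u P.1 - u P.2) / modulus nu kap (enorm (P.1 - P.2)).
have phi0 (P : 'rV[R]_n * 'rV[R]_n) : 0 < modulus nu kap (enorm (P.1 - P.2)).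
  by rewrite modulus_gt0// enorm_ge0.
have supQ : has_sup (range Q).
  split; first by exists (Q (0, 0)); exists (0, 0).
  exists (U / kap `^ nu) => _ [P _ <-].
  rewrite /Q ler_pdivrMr//; apply: (@le_trans _ _ U).
    by have := uU P.1; have := u_ge0 P.2; clear; lra.
  rewrite mulrAC ler_pdivlMr ?powR_gt0// ler_wpM2l//.
  case/andP: nu01 => _ _; apply: (ge0_ler_powR (ltW nu0)); rewrite ?nnegrE ?(ltW kap0)//.
    by rewrite addr_ge0 ?enorm_ge0// ltW.
  by rewrite lerDr enorm_ge0.
pose L := sup (range Q).
have hL a b : u a - u b <= L * modulus nu kap (enorm (a - b)).
  rewrite -ler_pdivrMr ?(phi0 (a, b))//.
  by apply: sup_upper_bound => //; exists (a, b).
pose B := 2 * (R0 `^ nu)^-1 * U + c^-1 `^ (p - 1)^-1 * N `^ (p - 1)^-1.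
have LB : L <= B.
  have B0 : 0 <= B by rewrite /B addr_ge0 ?mulr_ge0 ?powR_ge0 ?(ltW Ca).
  have [L0|L0] := leP L 0; first exact: le_trans B0.
  have nuL : 0 < nu * L by rewrite mulr_gt0.
  have [_ [P _ <-] PL] := sup_adherent nuL supQ.
  apply: (@modulus_quotient_bound s p c k0 nu Omega u N M U L kap R0 r0 P.1 P.2) => //.
  rewrite mulrA -ler_pdivlMr// ltW//.
  by have -> : (1 - nu) * L = L - nu * L by ring.
apply: le_trans (hL x y) _.
have m2 : modulus nu kap (enorm (x - y)) <= 2 * enorm (x - y) `^ nu.
  rewrite -/kap /modulus (_ : kap + kap = 2 * kap); last by ring.
  rewrite powRM ?(ltW kap0)//.
  rewrite ler_wpM2r ?powR_ge0//; apply: le_trans (powR2_le nu01) _.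
  by move: nu12; clear; lra.
have BC : 2 * B <= C * (U + N `^ (p - 1)^-1).
  have h1 : 0 <= (R0 `^ nu)^-1 * N `^ (p - 1)^-1 by rewrite mulr_ge0// ltW.
  have h2 : 0 <= c^-1 `^ (p - 1)^-1 * U by rewrite mulr_ge0// ltW.
  by rewrite /B /C; move: h1 h2; clear; lra.
have B0 : 0 <= B by rewrite /B addr_ge0 ?mulr_ge0 ?powR_ge0 ?(ltW Ca).
apply: (@le_trans _ _ (B * (2 * enorm (x - y) `^ nu))).
  apply: (@le_trans _ _ (B * modulus nu kap (enorm (x - y)))).
    by rewrite ler_wpM2r// ltW// (phi0 (x, y)).
  by rewrite ler_wpM2l.
by rewrite mulrA ler_wpM2r ?powR_ge0// mulrC.
Qed.

End global_estimate.

(** * Essential suprema and solutions *)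

Section essential_supremum.
Context {R : realType} {n : nat}.
Implicit Types (x y w z q : 'rV[R]_n) (u v g : 'rV[R]_n -> R) (Omega : set 'rV[R]_n).
Local Notation mu := (@lebesgue_rV R n).

Lemma eball_measure_gt0 x (r : R) : 0 < r -> (0 < mu (eball x r))%E.
Proof.
move=> r0; apply: lt_le_trans (lebesgue_eball_ge x r0).
by rewrite lte_fin exprn_gt0// mulr_gt0// divr_gt0.
Qed.

Lemma lebesgue_rV_setT_gt0 : (0 < mu [set: 'rV[R]_n])%E.
Proof.
apply: lt_le_trans (eball_measure_gt0 0 ltr01) _.
by apply: le_measure => //; rewrite inE//; exact: measurable_eball.
Qed.

(** A null set has empty interior, hence an essential bound holds on a dense subset. *)
Lemma Linfty_normP Omega g : open Omega -> [bounded g x | x in Omega] ->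
  exists F : R, [/\ Linfty_norm Omega g = F%:E, 0 <= F &
    forall x, Omega x -> forall e : R, 0 < e ->
      exists y, [/\ Omega y, enorm (y - x) < e & `|g y| <= F]].
Proof.
move=> oO [M [_ HM]].
pose h : 'rV[R]_n -> \bar R := fun x => (g x * \1_Omega x)%:E.
have LE : Linfty_norm Omega g = ess_sup mu (abse \o h).
  by rewrite /Linfty_norm unlock lebesgue_rV_setT_gt0.
have L0 : (0 <= Linfty_norm Omega g)%E.
  rewrite LE; apply: ess_sup_gee; first exact: lebesgue_rV_setT_gt0.
  by apply/aeW => x; exact: abse_ge0.
have LM : (Linfty_norm Omega g <= (Num.max (M + 1) 0)%:E)%E.
  rewrite LE; apply/ess_supP; apply/aeW => x /=; rewrite lee_fin.
  have [Ox|Ox] := pselect (Omega x).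
    rewrite indicE mem_set// mulr1 le_max; apply/orP; left.
    by apply: HM Ox; rewrite ltrDl.
  by rewrite indicE memNset// mulr0 normr0 le_max lexx orbT.
have Lfin : Linfty_norm Omega g \is a fin_num.
  by rewrite ge0_fin_numE//; apply: le_lt_trans LM _; rewrite ltry.
exists (fine (Linfty_norm Omega g)); rewrite fineK//; split => //; first exact: fine_ge0.
move=> x Ox e e0.
have [d d0 dO] : exists2 d : R, 0 < d & eball x d `<=` Omega.
  by apply/nbhs_eballP; exact: open_nbhs_nbhs.
pose r := Num.min d e; have r0 : 0 < r by rewrite lt_min d0 e0.
apply: contrapT => noy.
have [A [mA A0 HA]] := ess_sup_ge mu (abse \o h).
have : eball x r `<=` A.
  move=> y /= yx; apply: HA => /= hy; apply: noy; exists y.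
  have Oy : Omega y by apply: dO; apply: lt_le_trans yx _; rewrite ge_min lexx.
  split => //; first by apply: lt_le_trans yx _; rewrite ge_min lexx orbT.
  move: hy; rewrite -LE -lee_fin fineK//.
  by rewrite /h indicE mem_set// mulr1.
move=> xA; have : (mu (eball x r) <= mu A)%E.
  by apply: le_measure => //; rewrite inE//; exact: measurable_eball.
have -> : mu A = 0%E by exact: A0.
by rewrite leNgt eball_measure_gt0.
Qed.

End essential_supremum.

Section solutions.
Context {R : realType} {n : nat}.
Implicit Types (x y w z q : 'rV[R]_n) (u v g : 'rV[R]_n -> R) (Omega : set 'rV[R]_n).

Lemma fplap_trunc_cvg (Cnsp s p : R) u x (a : R) : 0 < Cnsp ->
  fplap_cvg s p u x -> fplap Cnsp s p u x = a%:E ->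
  fplap_trunc s p u x eps @[eps --> 0^'+] --> (a / Cnsp)%:E.
Proof.
move=> C0 cu; rewrite /fplap => E.
suff <- : lim (fplap_trunc s p u x eps @[eps --> 0^'+]) = (a / Cnsp)%:E by exact: cu.
move: E; case: (lim _) => [l| |] /=.
- by rewrite -EFinM => -[<-]; rewrite mulrAC mulfV ?mul1r// gt_eqF.
- by rewrite gt0_muley ?lte_fin.
- by rewrite gt0_muleNy ?lte_fin.
Qed.

Lemma fplap_truncN_cvg (s p M : R) u x (a : R) :
  2 <= p -> 0 < s -> measurable_fun setT u -> (forall w, `|u w| <= M) ->
  fplap_trunc s p u x eps @[eps --> 0^'+] --> a%:E ->
  fplap_trunc s p (fun w => - u w) x eps @[eps --> 0^'+] --> (- a)%:E.
Proof.
move=> p2 s0 mu_ uM cu; rewrite EFinN.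
apply: (cvg_trans _ (cvgeN cu)); apply: near_eq_cvg.
near=> eps; rewrite (@fplap_truncN _ _ _ _ _ _ M)//.
Unshelve. all: by end_near.
Qed.

(** The points where [|f|] is at most its essential supremum are dense in [Omega]. *)
Lemma solution_admissible (Cnsp s p M F : R) Omega (f : 'rV[R]_n -> R -> R) u :
  2 <= p -> 0 < s -> 0 < Cnsp -> open Omega -> C11loc Omega u ->
  measurable_fun setT u -> (forall w, `|u w| <= M) ->
  dirichlet_solution Cnsp s p Omega f u ->
  (forall x, Omega x -> forall e : R, 0 < e ->
      exists y, [/\ Omega y, enorm (y - x) < e & `|f y (u y)| <= F]) ->
  forall x, Omega x -> admissible_point s p u (F / Cnsp) x.
Proof.
move=> p2 s0 C0 oO c11 mu_ uM [sol _] dense x Ox; split.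
- exact: C11loc_continuous Ox.
- exact: C11loc_below_paraboloid Ox.
- exact: C11loc_below_paraboloidN Ox.
- move=> e /(dense x Ox)[y [Oy yx fy]]; exists y => //.
  have [cy Ey] := sol y Oy; exists (f y (u y) / Cnsp); last exact: fplap_trunc_cvg.
  by rewrite ler_wpM2r ?invr_ge0 ?(ltW C0)// (le_trans (ler_norm _)).
- move=> e /(dense x Ox)[y [Oy yx fy]]; exists y => //.
  have [cy Ey] := sol y Oy; exists (- (f y (u y) / Cnsp)).
    rewrite -mulNr ler_wpM2r ?invr_ge0 ?(ltW C0)//.
    by rewrite (le_trans (ler_norm _))// normrN.
  by apply: (fplap_truncN_cvg p2 s0 mu_ uM); exact: fplap_trunc_cvg.
Qed.

End solutions.

Theorem theorem3 (R : realType) (n : nat) (s p Cnsp : R)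
    (Omega : set 'rV[R]_n)
    (n_gt0 : (0 < n)%N) (s_gt0 : 0 < s) (s_lt1 : s < 1) (p_ge2 : 2 <= p)
    (Cnsp_gt0 : 0 < Cnsp)
    (domOmega : domain Omega) (ballOmega : two_sided_ball_condition Omega) :
  exists nu0 : R, 0 < nu0 < s /\
  exists Cnu0 C : R, [/\ 0 < Cnu0, 0 < C &
    forall (f : 'rV[R]_n -> R -> R) (u : 'rV[R]_n -> R),
      C11loc Omega u -> Lsp s p u ->
      [bounded u x | x in [set: 'rV[R]_n]] ->
      (forall x, Omega x -> 0 < u x) ->
      [bounded f x (u x) | x in Omega] ->
      dirichlet_solution Cnsp s p Omega f u ->
      holder_space nu0 u /\
      (holder_seminorm nu0 u <=
        Cnu0%:E * (1 + Linfty_norm Omega u +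
          C%:E * Linfty_norm Omega (fun x => f x (u x)) `^ (p - 1)^-1))%E].
Proof.
have [oO _ _] := domOmega; have [r0 r00 balls] := ballOmega.
have ext z : boundary Omega z -> exists b, enorm (z - b) = r0 /\
    forall w, eball b r0 w -> ~ Omega w.
  move=> /balls[_ [b [_ bO _ bz]]]; exists b; split; first exact: boundary_eball.
  by move=> w /bO Ow /subset_closure.
have [nu [C [nus C0 est]]] := holder_estimate p_ge2 s_gt0 s_lt1 r00 oO ext.
exists nu; split => //; exists C, (Cnsp^-1 `^ (p - 1)^-1); split => //.
  by apply: powR_gt0; rewrite invr_gt0.
move=> f u c11 _ bu upos bf sol.
have [M uM] : exists M : R, forall w, `|u w| <= M.
  have [M [_ HM]] := bu; exists (M + 1) => w.
  by apply: HM => //; rewrite ltrDl.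
have u0 := sol.2.
have mu_ := extension_by0_measurable oO c11 upos u0.
have bu' : [bounded u x | x in Omega].
  by have [M' [M'r HM]] := bu; exists M'; split => // x M'x y _; exact: HM.
have [U [UE U0 Udense]] := Linfty_normP oO bu'.
have [F [FE F0 Fdense]] := Linfty_normP oO bf.
have uU w : u w <= U.
  have [Ow|/u0 ->//] := pselect (Omega w).
  rewrite leNgt; apply/negP => Uw.
  have nw : nbhs (u w) [set t | U < t] by apply: open_nbhs_nbhs; split => //; exact: open_gt.
  have /nbhs_eballP[e e0 eU] : nbhs w (u @^-1` [set t | U < t]).
    exact: (C11loc_continuous c11 Ow) _ nw.
  have [y [Oy yw uy]] := Udense w Ow e e0.
  have := eU y yw; rewrite /= ltNge; apply/negP; rewrite negbK.
  exact: le_trans (ler_norm _) uy.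
have adm := solution_admissible p_ge2 s_gt0 Cnsp_gt0 oO c11 mu_ uM sol Fdense.
have FC0 : 0 <= F / Cnsp by rewrite divr_ge0// ltW.
have E := est u (F / Cnsp) M U mu_ uM adm upos u0 uU FC0.
have FCE : (F / Cnsp) `^ (p - 1)^-1 = Cnsp^-1 `^ (p - 1)^-1 * F `^ (p - 1)^-1.
  by rewrite mulrC powRM// invr_ge0 ltW.
have bound : (holder_seminorm nu u <=
    (C * (1 + U + Cnsp^-1 `^ (p - 1)^-1 * F `^ (p - 1)^-1))%:E)%E.
  apply: ub_ereal_sup => _ [[x y] /= xy <-]; rewrite lee_fin.
  have xy0 : 0 < enorm (x - y) by rewrite enorm_gt0// subr_eq0.
  rewrite ler_pdivrMr ?powR_gt0//.
  have le1 a b : u a - u b <= C * (1 + U + Cnsp^-1 `^ (p - 1)^-1 * F `^ (p - 1)^-1) *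
      enorm (a - b) `^ nu.
    apply: le_trans (E a b) _; rewrite FCE ler_wpM2r ?powR_ge0// ler_wpM2l ?(ltW C0)//.
    by rewrite lerD2r lerDr.
  rewrite ler_norml; apply/andP; split; last exact: le1.
  by rewrite lerNl opprB enormB; exact: le1.
rewrite UE FE poweR_EFin; split; last exact: bound.
by split => //; apply: le_lt_trans bound _; rewrite ltry.
Qed.
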